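(* Let $\lambda=(\lambda_1,\dots,\lambda_n)$ be a $\mathfrak{gl}_n$-weight and let $1\le k\le n$ be such that: (i) there exists $A=\{a_1<a_2<\dots<a_k\}\subseteq\{1,\dots,n\}$ such that $\lambda_i-\lambda_j\in\mathbb Z$ with $i\ne j$ implies $i,j\in A$; (ii) there exists $\tau\in S_k$ such that the $\mathfrak{gl}_k$-weight $$\mu_A:=(\lambda_{a_1},\dots,\lambda_{a_k})+(1-a_1,1-a_2,\dots,1-a_k)-(0,-1,\dots,1-k)$$ is a $\tau$-relation weight. Then there exist at least $p\,(n-k)!$ permutations $\sigma\in S_n$ such that $\lambda$ is a $\sigma$-relation weight, where $p=\#\{\tau\in S_k : \mu_A \text{ is a } \tau\text{-relation weight}\}$.
   Context: A $\mathfrak{gl}_m$-weight is a tuple $\lambda=(\lambda_1,\dots,\lambda_m)\in\mathbb C^m$ ($\lambda_i$ is the value on the matrix unit $E_{ii}$); $\bar\lambda=\lambda+(0,-1,\dots,-m+1)$. The definitions below are for $\mathfrak{gl}_m$, any $m\ge1$ (used with $m=n$ and $m=k$). **Graphs $G_\sigma$ ($\sigma\in S_m$).** Let $\mathfrak V=\{(i,j): 1\le j\le i\le m\}$; $(k,1),\dots,(k,k)$ form row $k$, row $m$ being the top row. $\Sigma$ is the set of directed graphs on $\mathfrak V$ having, for each $1\le s<r\le m$, exactly one of the arrows $(r,s)\to(r-1,s)$ (then $A_{(r,s)}(G)=1$) or $(r-1,s)\to(r,s)$ (then $A_{(r,s)}(G)=-1$), and no other arrows. Let $\alpha_{ij}=\varepsilon_i-\varepsilon_j$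 ($i\ne j$), $\Delta^+=\{\alpha_{ij}: i<j\}$, $\sigma(\alpha_{ij})=\alpha_{\sigma(i)\sigma(j)}$, and for $G\in\Sigma$ put $\mathcal Q_G=\{\alpha_{ij}: i<j, A_{(j,i)}(G)=1\}\cup\{\alpha_{ji}: i<j, A_{(j,i)}(G)=-1\}$. $G_\sigma$ is the unique element of $\Sigma$ with $\mathcal Q_{G_\sigma}=\sigma(\Delta^+)$. **Tableaux.** A Gelfand-Tsetlin tableau $T(L)$ is a triangular array of complex numbers $l_{ij}$ indexed by $(i,j)\in\mathfrak V$. For $X\in\mathbb C^m$, $T_\sigma(X)=T(Y)$ is defined by $y_{m,i}=x_{\sigma^{-1}(i)}$ and, recursively for $k=m,\dots,2$ and $1\le i\le k-1$, $y_{k-1,i}=y_{k,i}$ if $G_\sigma$ has an arrow $(k,i)\to(k-1,i)$, and $y_{k-1,i}=y_{k,i}+1$ if $G_\sigma$ has an arrow $(k-1,i)\to(k,i)$. **Relation graphs.** All graphs are directed graphs on $\mathfrak V$ whose arrows connect only vertices in consecutive rows or vertices of row $m$, without oriented cycles or multiple arrows. $G$ is non-critical if any two vertices in the same row $k<m$ lying in the same connected component of the underlying unoriented graph are joined by an oriented path from one to the other. $T(L)$ satisfies $G$ if for each arrow $(i,j)\to(r,s)$ one has $l_{ij}-l_{rs}\in\mathbb Z_{\ge0}$ when the arrow is horizontal or points down ($r=i-1$), and $l_{ij}-l_{rs}\in\mathbb Z_{>0}$ when it points up ($r=i+1$). $T(L)$ is a $G$-realization if it satisfies $G$ and, for all $1\le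 k\le m-1$, $l_{ki}-l_{kj}\in\mathbb Z$ only if $(k,i),(k,j)$ are in the same connected component. For a $G$-realization $T(L)$, $V_G(T(L))$ is the complex vector space with basis all $G$-realizations $T(L+z)$, $z$ an integer array with $z_{mi}=0$ for all $i$. A non-critical $G$ is a relation graph if for every $G$-realization $T(L)$ the Gelfand-Tsetlin formulas $$E_{k,k+1}T(L)=-\sum_{i=1}^k\frac{\prod_{j=1}^{k+1}(l_{ki}-l_{k+1,j})}{\prod_{j\ne i}(l_{ki}-l_{kj})}T(L+\delta^{ki}),\quad E_{k+1,k}T(L)=\sum_{i=1}^k\frac{\prod_{j=1}^{k-1}(l_{ki}-l_{k-1,j})}{\prod_{j\ne i}(l_{ki}-l_{kj})}T(L-\delta^{ki}),$$ $$E_{kk}T(L)=\Big(k-1+\sum_{i=1}^kl_{ki}-\sum_{i=1}^{k-1}l_{k-1,i}\Big)T(L)$$ define a $\mathfrak{gl}_m$-module structure on $V_G(T(L))$; here $T(L\pm\delta^{ki})$ is $T(L)$ with $\pm1$ added to entry $(k,i)$, and a summand is $0$ by definition if the new tableau is not a $G$-realization. **Graph of a tableau.** $G(T(L))$ is the transitive reduction (same reachability, minimal set of arrows) of the graph on $\mathfrak V$ with an arrow $(i,j)\to(r,s)$ if: (i) $i=r+1$ and $l_{ij}-l_{rs}\in\mathbb Z_{\ge0}$; or (ii) $i=r-1$ and $l_{ij}-l_{rs}\in\mathbb Z_{>0}$; or (iii) $i=r=m$, $j\neq s$, and $l_{mj}-l_{ms}\in\mathbb Z_{\ge0}$, where if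 $l_{mj}=l_{ms}$ only the arrow from the smaller to the larger index is taken. **$\sigma$-relation weight.** For $\sigma\in S_m$, a $\mathfrak{gl}_m$-weight $\lambda$ is a $\sigma$-relation weight if $G(T_\sigma(\bar\lambda))$ is a relation graph. *)

(* Defs.v *)
(* The complex numbers are R[i] for R : realType.  All indices start at 0:    *)
(* rows and columns of a triangular array of size m run over 0, ..., m - 1,   *)
(* and the top row is row m - 1.                                              *)
From HB Require Import structures.
From mathcomp Require Import all_boot all_order all_fingroup all_algebra.
From mathcomp Require Import boolp reals complex.
From mathcomp.multinomials Require Import monalg.

Set Implicit Arguments.
Unset Strict Implicit.
Unset Printing Implicit Defensive.

Import GRing.Theory Num.Theory.

Local Open Scope ring_scope.

Definition is_int (R : realType) (x : R[i]) : Prop := exists z : int, x = z%:~R.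
Definition is_nat (R : realType) (x : R[i]) : Prop := exists n : nat, x = n%:R.
Definition is_posnat (R : realType) (x : R[i]) : Prop :=
  exists n : nat, x = n.+1%:R.

(* The vertex with val v = (i, j) is in row i and column j. *)
Record vertex (m : nat) : predArgType :=
  Vertex { vpair : 'I_m * 'I_m; _ : (vpair.2 <= vpair.1)%N }.
HB.instance Definition _ (m : nat) := [isSub for @vpair m].
HB.instance Definition _ (m : nat) := [Finite of vertex m by <:].

Definition vrow (m : nat) (v : vertex m) : nat := (val v).1.
Definition vcol (m : nat) (v : vertex m) : 'I_m := (val v).2.
Definition top (m : nat) (v : vertex m) : bool := (vrow v).+1 == m.

(* A directed graph without multiple arrows is its set of arrows. *)
Definition graph (m : nat) := {set vertex m * vertex m}.

Definition arrow (m : nat) (G : graph m) : rel (vertex m) :=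
  fun u v => (u, v) \in G.

Definition has_arrow (m : nat) (G : graph m) (a b : nat * nat) : bool :=
  [exists u, exists v, [&& arrow G u v,
    (vrow u, val (vcol u)) == a & (vrow v, val (vcol v)) == b]].

(* Whether A_(r,s)(G) is 1, respectively -1, for r > s. *)
Definition down_arrow (m : nat) (G : graph m) (r s : nat) : bool :=
  has_arrow G (r, s) (r.-1, s).
Definition up_arrow (m : nat) (G : graph m) (r s : nat) : bool :=
  has_arrow G (r.-1, s) (r, s).

Definition in_Sigma (m : nat) (G : graph m) : bool :=
  [forall u, forall v, (vrow u == (vrow v).+1) && (vcol u == vcol v) ==>
     (arrow G u v (+) arrow G v u)] &&
  [forall u, forall v, arrow G u v ==> (vcol u == vcol v) &&
     ((vrow u == (vrow v).+1) || (vrow v == (vrow u).+1))].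

(* The root alpha_ij is the pair (i, j). *)
Definition pos_roots (m : nat) : {set 'I_m * 'I_m} := [set a : 'I_m * 'I_m | (a.1 < a.2)%N].

Definition perm_roots (m : nat) (sigma : 'S_m) (D : {set 'I_m * 'I_m}) :
    {set 'I_m * 'I_m} :=
  [set (sigma a.1, sigma a.2) | a in D].

Definition graph_roots (m : nat) (G : graph m) : {set 'I_m * 'I_m} :=
  [set a : 'I_m * 'I_m | (a.1 < a.2)%N & down_arrow G a.2 a.1] :|:
  [set a : 'I_m * 'I_m | (a.2 < a.1)%N & up_arrow G a.1 a.2].

Definition is_Gsigma (m : nat) (sigma : 'S_m) (G : graph m) : bool :=
  in_Sigma G && (graph_roots G == perm_roots sigma (pos_roots m)).

(* The default value is never used: see GsigmaP and Gsigma_uniq. *)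
Definition Gsigma (m : nat) (sigma : 'S_m) : graph m :=
  odflt set0 [pick G | is_Gsigma sigma G].

Definition tableau (R : realType) (m : nat) := {ffun vertex m -> R[i]}.
HB.instance Definition _ (R : realType) (m : nat) := Choice.on (tableau R m).

(* The entry in column s, d rows below the top row; it is meaningful for      *)
(* s <= m - 1 - d.                                                            *)
Fixpoint Tsigma_entry (R : realType) (m : nat) (sigma : 'S_m) (X : 'I_m -> R[i])
    (d : nat) (s : 'I_m) : R[i] :=
  if d is d'.+1 then
    let y := Tsigma_entry sigma X d' s in
    if down_arrow (Gsigma sigma) (m.-1 - d') s then y else y + 1
  else X ((sigma^-1)%g s).

Definition Tsigma (R : realType) (m : nat) (sigma : 'S_m) (X : 'I_m -> R[i]) :
    tableau R m :=
  [ffun v => Tsigma_entry sigma X (m.-1 - vrow v) (vcol v)].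

Definition admissible (m : nat) (G : graph m) : Prop :=
  (forall u v, arrow G u v ->
     [|| vrow u == (vrow v).+1, vrow v == (vrow u).+1 | top u && top v]) /\
  (forall p : seq (vertex m), path.cycle (arrow G) p -> p = [::]).

Definition same_component (m : nat) (G : graph m) : rel (vertex m) :=
  connect (fun u v => arrow G u v || arrow G v u).

Definition noncritical (m : nat) (G : graph m) : Prop :=
  forall u v, vrow u = vrow v -> ~~ top u -> same_component G u v ->
    connect (arrow G) u v || connect (arrow G) v u.

Definition satisfies (R : realType) (m : nat) (G : graph m) (L : tableau R m) :
    Prop :=
  forall u v, arrow G u v ->
    if vrow v == (vrow u).+1 then is_posnat (L u - L v) else is_nat (L u - L v).

Definition realization (R : realType) (m : nat) (G : graph m)
    (L : tableau R m) : Prop :=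
  satisfies G L /\
  (forall u v, vrow u = vrow v -> ~~ top u -> is_int (L u - L v) ->
     same_component G u v).

Definition integral_shift (R : realType) (m : nat) (L L' : tableau R m) : Prop :=
  exists z : {ffun vertex m -> int},
    (forall v, top v -> z v = 0) /\ (forall v, L' v = L v + (z v)%:~R).

Record VGbasis (R : realType) (m : nat) (G : graph m) (L : tableau R m) :
    predArgType :=
  VGBasis { VGtableau : tableau R m;
            _ : `[< realization G VGtableau /\ integral_shift L VGtableau >] }.
HB.instance Definition _ (R : realType) (m : nat) (G : graph m)
    (L : tableau R m) := [isSub for @VGtableau R m G L].
HB.instance Definition _ (R : realType) (m : nat) (G : graph m)
    (L : tableau R m) := [Choice of VGbasis G L by <:].

(* The free complex vector space on VGbasis G L. *)
Definition VG (R : realType) (m : nat) (G : graph m) (L : tableau R m) :=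
  {malg R[i][VGbasis G L]}.
HB.instance Definition _ (R : realType) (m : nat) (G : graph m)
    (L : tableau R m) :=
  GRing.Lmodule.on (VG G L).

Definition basis_vector (R : realType) (m : nat) (G : graph m)
    (L : tableau R m) (b : VGbasis G L) : VG G L := << b >>.

Definition tableau_vector (R : realType) (m : nat) (G : graph m)
    (L : tableau R m) (L' : tableau R m) : VG G L :=
  if insub L' is Some b then basis_vector b else 0.

Definition shift_entry (R : realType) (m : nat) (L : tableau R m)
    (v : vertex m) (c : R[i]) : tableau R m :=
  [ffun w => if w == v then L w + c else L w].

Definition GT_raise (R : realType) (m : nat) (G : graph m) (L0 : tableau R m)
    (k : nat) (L : tableau R m) : VG G L0 :=
  - \sum_(v : vertex m | vrow v == k)
      ((\prod_(w : vertex m | vrow w == k.+1) (L v - L w)) /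
       (\prod_(w : vertex m | (vrow w == k) && (w != v)) (L v - L w)))
      *: tableau_vector G L0 (shift_entry L v 1).

Definition GT_lower (R : realType) (m : nat) (G : graph m) (L0 : tableau R m)
    (k : nat) (L : tableau R m) : VG G L0 :=
  \sum_(v : vertex m | vrow v == k)
      ((\prod_(w : vertex m | (vrow w).+1 == k) (L v - L w)) /
       (\prod_(w : vertex m | (vrow w == k) && (w != v)) (L v - L w)))
      *: tableau_vector G L0 (shift_entry L v (-1)).

Definition GT_diag (R : realType) (m : nat) (G : graph m) (L0 : tableau R m)
    (k : nat) (L : tableau R m) : VG G L0 :=
  (k%:R + \sum_(w : vertex m | vrow w == k) L w
        - \sum_(w : vertex m | (vrow w).+1 == k) L w)
  *: tableau_vector G L0 L.

Definition gl_module (K : fieldType) (m : nat) (W : lmodType K)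
    (rho : 'M[K]_m -> W -> W) : Prop :=
  [/\ forall A c u v, rho A (c *: u + v) = c *: rho A u + rho A v,
      forall c A B u, rho (c *: A + B) u = c *: rho A u + rho B u
    & forall A B u,
        rho (A *m B - B *m A) u = rho A (rho B u) - rho B (rho A u)].

Definition GT_formulas_define_module (R : realType) (m : nat) (G : graph m)
    (L0 : tableau R m) : Prop :=
  exists rho : 'M[R[i]]_m -> VG G L0 -> VG G L0,
  [/\ gl_module rho,
      forall (i j : 'I_m) (b : VGbasis G L0), j = i.+1 :> nat ->
        rho (delta_mx i j) (basis_vector b) = GT_raise G L0 i (val b),
      forall (i j : 'I_m) (b : VGbasis G L0), j = i.+1 :> nat ->
        rho (delta_mx j i) (basis_vector b) = GT_lower G L0 i (val b)
    & forall (i : 'I_m) (b : VGbasis G L0),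
        rho (delta_mx i i) (basis_vector b) = GT_diag G L0 i (val b)].

Definition relation_graph (R : realType) (m : nat) (G : graph m) : Prop :=
  [/\ admissible G, noncritical G
    & forall L : tableau R m, realization G L -> GT_formulas_define_module G L].

Definition full_tableau_graph (R : realType) (m : nat) (L : tableau R m) :
    graph m :=
  [set e : vertex m * vertex m | let: (u, v) := e in
    `[< [\/ vrow u = (vrow v).+1 /\ is_nat (L u - L v),
            vrow v = (vrow u).+1 /\ is_posnat (L u - L v)
          | [/\ top u, top v, u != v, is_nat (L u - L v)
              & L u = L v -> (vcol u < vcol v)%N]] >]].

Definition same_reachability (m : nat) (G H : graph m) : bool :=
  [forall u, forall v, connect (arrow G) u v == connect (arrow H) u v].

Definition transitive_reduction (m : nat) (G H : graph m) : bool :=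
  minset (same_reachability G) H.

(* full_tableau_graph L is acyclic, so it has exactly one transitive          *)
(* reduction: see tableau_graphP and tableau_graph_uniq.                      *)
Definition tableau_graph (R : realType) (m : nat) (L : tableau R m) : graph m :=
  odflt set0 [pick H | transitive_reduction (full_tableau_graph L) H].

Definition bar_weight (R : realType) (m : nat) (lambda : 'I_m -> R[i]) :
    'I_m -> R[i] :=
  fun i => lambda i - i%:R.

Definition relation_weight (R : realType) (m : nat) (sigma : 'S_m)
    (lambda : 'I_m -> R[i]) : Prop :=
  relation_graph R (tableau_graph (Tsigma sigma (bar_weight lambda))).

(* a i + 1 and i + 1 are the indices counted from 1. *)
Definition mu_weight (R : realType) (n k : nat) (lambda : 'I_n -> R[i])
    (a : 'I_k -> 'I_n) : 'I_k -> R[i] :=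
  fun i => lambda (a i) + (1 - (a i).+1%:R) - (1 - i.+1%:R).

Lemma vertex_eq (m : nat) (u v : vertex m) :
  vrow u = vrow v -> vcol u = vcol v -> u = v.
Proof.
rewrite /vrow /vcol => er ec; apply: val_inj.
by case: (val u) (val v) er ec => [a b] [c d] /= /val_inj -> ->.
Qed.

Lemma vcol_le (m : nat) (u : vertex m) : (vcol u <= vrow u)%N.
Proof. by case: u. Qed.

Lemma vrow_lt (m : nat) (u : vertex m) : (vrow u < m)%N.
Proof. by rewrite /vrow ltn_ord. Qed.

Lemma vertex_ex (m : nat) (i j : nat) : (j <= i)%N -> (i < m)%N ->
  exists2 u : vertex m, vrow u = i & vcol u = j :> nat.
Proof.
move=> ji im; have jm := leq_ltn_trans ji im.
by exists (@Vertex m (Ordinal im, Ordinal jm) ji).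
Qed.

Lemma has_arrowE (m : nat) (G : graph m) (u v : vertex m) :
  has_arrow G (vrow u, val (vcol u)) (vrow v, val (vcol v)) = arrow G u v.
Proof.
apply/existsP/idP => [[u' /existsP[v' /and3P[Guv /eqP[ru cu] /eqP[rv cv]]]]|Guv].
  by rewrite -(vertex_eq ru (val_inj cu)) -(vertex_eq rv (val_inj cv)).
by exists u; apply/existsP; exists v; rewrite Guv !eqxx.
Qed.

Lemma down_arrowE (m : nat) (G : graph m) (u v : vertex m) :
  vrow u = (vrow v).+1 -> vcol u = vcol v ->
  down_arrow G (vrow u) (vcol u) = arrow G u v.
Proof. by move=> er ec; rewrite -has_arrowE /down_arrow er -ec. Qed.

Lemma up_arrowE (m : nat) (G : graph m) (u v : vertex m) :
  vrow u = (vrow v).+1 -> vcol u = vcol v ->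
  up_arrow G (vrow u) (vcol u) = arrow G v u.
Proof. by move=> er ec; rewrite -has_arrowE /up_arrow er -ec. Qed.

Lemma perm_rootsP (m : nat) (sigma : 'S_m) (i j : 'I_m) :
  ((i, j) \in perm_roots sigma (pos_roots m)) =
  ((sigma^-1)%g i < (sigma^-1)%g j)%N.
Proof.
apply/imsetP/idP => [[[a b]]|ij].
  by rewrite inE /= => ab [-> ->]; rewrite !permK.
by exists ((sigma^-1)%g i, (sigma^-1)%g j); rewrite ?inE //= !permKV.
Qed.

Lemma is_Gsigma_arrow (m : nat) (sigma : 'S_m) (G : graph m) :
  is_Gsigma sigma G -> forall u v : vertex m, arrow G u v =
    (vcol u == vcol v) &&
    ((vrow u == (vrow v).+1) &&
       ((sigma^-1)%g (vcol u) < (sigma^-1)%g (val u).1)%N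
     || (vrow v == (vrow u).+1) &&
       ((sigma^-1)%g (val v).1 < (sigma^-1)%g (vcol v))%N).
Proof.
move=> /andP[/andP[/forallP _ /forallP GS] /eqP GQ] u v.
have Guv : arrow G u v -> (vcol u == vcol v) &&
     ((vrow u == (vrow v).+1) || (vrow v == (vrow u).+1)).
  by move: (GS u) => /forallP/(_ v)/implyP.
case: eqP Guv => [ec /= Guv|_ /=]; last by case: arrow => // /(_ isT).
have [er|ner] := eqVneq (vrow u) (vrow v).+1.
  have -> : (vrow v == (vrow u).+1) = false by rewrite er ltn_eqF.
  rewrite orbF -perm_rootsP -GQ !inE /= -/(vrow u).
  have lt : (vcol u < vrow u)%N by rewrite er ec ltnS vcol_le.
  by rewrite lt ltnNge (ltnW lt) orbF (down_arrowE _ er ec).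
have [er|ner'] /= := eqVneq (vrow v) (vrow u).+1.
  rewrite -perm_rootsP -GQ !inE /= -/(vrow v).
  have lt : (vcol v < vrow v)%N by rewrite er -ec ltnS vcol_le.
  by rewrite lt ltnNge (ltnW lt) /= (up_arrowE _ er (esym ec)).
by apply/negbTE/negP=> /Guv; rewrite (negbTE ner) (negbTE ner').
Qed.

Lemma Gsigma_uniq (m : nat) (sigma : 'S_m) (G H : graph m) :
  is_Gsigma sigma G -> is_Gsigma sigma H -> G = H.
Proof.
move=> GP HP; apply/setP => -[u v].
by have := is_Gsigma_arrow GP u v; rewrite -(is_Gsigma_arrow HP).
Qed.

Lemma GsigmaP (m : nat) (sigma : 'S_m) : is_Gsigma sigma (Gsigma sigma).
Proof.
rewrite /Gsigma; case: pickP => //= /(_ [set e : vertex m * vertex m |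
    (vcol e.1 == vcol e.2) &&
    ((vrow e.1 == (vrow e.2).+1) &&
       ((sigma^-1)%g (vcol e.1) < (sigma^-1)%g (val e.1).1)%N
     || (vrow e.2 == (vrow e.1).+1) &&
       ((sigma^-1)%g (val e.2).1 < (sigma^-1)%g (vcol e.2))%N)]).
set G := [set e | _]; move=> /negP[].
have GE u v : arrow G u v =
    (vcol u == vcol v) &&
    ((vrow u == (vrow v).+1) &&
       ((sigma^-1)%g (vcol u) < (sigma^-1)%g (val u).1)%N
     || (vrow v == (vrow u).+1) &&
       ((sigma^-1)%g (val v).1 < (sigma^-1)%g (vcol v))%N).
  by rewrite /arrow inE.
have neq (w : vertex m) : (vcol w < vrow w)%N ->
    ((sigma^-1)%g (vcol w) < (sigma^-1)%g (val w).1)%N =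
    ~~ ((sigma^-1)%g (val w).1 < (sigma^-1)%g (vcol w))%N.
  move=> lt; rewrite -leqNgt ltn_neqAle andb_idl // => _.
  by rewrite val_eqE (inj_eq perm_inj) -val_eqE ltn_eqF.
apply/andP; split; first (apply/andP; split; apply/forallP => u; apply/forallP => v).
- apply/implyP => /andP[/eqP er /eqP ec]; rewrite !GE er ec !eqxx /=.
  rewrite [vrow v == _]ltn_eqF ?er // orbF /=.
  have lt : (vcol u < vrow u)%N by rewrite er ec ltnS vcol_le.
  by move: (neq u lt); rewrite ec => ->; case: (X in ~~ X (+) _).
- by apply/implyP; rewrite GE => /andP[->] /orP[] /andP[->] //=; rewrite orbT.
apply/eqP/setP => -[i j]; rewrite perm_rootsP !inE /=.
case: (ltngtP i j) => [ij|ji|/val_inj ->] /=; last by rewrite ltnn.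
- have j0 : (0 < j)%N by apply: leq_ltn_trans ij.
  have [|u ru cu] := @vertex_ex m j i (ltnW ij); first exact: ltn_ord.
  have [||v rv cv] := @vertex_ex m j.-1 i.
  + by rewrite -ltnS prednK.
  + by rewrite prednK // ltnW // ltn_ord.
  have er : vrow u = (vrow v).+1 by rewrite ru rv prednK.
  have ec : vcol u = vcol v by apply: val_inj; rewrite /= cu cv.
  rewrite orbF -[X in down_arrow _ X _]ru -cu (down_arrowE _ er ec) GE ec er !eqxx.
  rewrite [vrow v == _]ltn_eqF ?er // orbF /=.
  by rewrite (_ : (val u).1 = j) 1?(_ : vcol v = i) //; apply: val_inj.
- have j0 : (0 < i)%N by apply: leq_ltn_trans ji.
  have [|u ru cu] := @vertex_ex m i j (ltnW ji); first exact: ltn_ord.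
  have [||v rv cv] := @vertex_ex m i.-1 j.
  + by rewrite -ltnS prednK.
  + by rewrite prednK // ltnW // ltn_ord.
  have er : vrow u = (vrow v).+1 by rewrite ru rv prednK.
  have ec : vcol u = vcol v by apply: val_inj; rewrite /= cu cv.
  rewrite -[X in up_arrow _ X _]ru -cu (up_arrowE _ er ec) GE ec er !eqxx.
  rewrite [vrow v == _]ltn_eqF ?er //=.
  by rewrite (_ : (val u).1 = i) 1?(_ : vcol v = j) //; apply: val_inj.
Qed.

Lemma Tsigma_top (R : realType) (m : nat) (sigma : 'S_m) (X : 'I_m -> R[i])
    (v : vertex m) :
  top v -> Tsigma sigma X v = X ((sigma^-1)%g (vcol v)).
Proof. by move=> /eqP/(congr1 predn) /= tv; rewrite ffunE tv subnn. Qed.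

Lemma Tsigma_down (R : realType) (m : nat) (sigma : 'S_m) (X : 'I_m -> R[i])
    (u v : vertex m) :
  vrow u = (vrow v).+1 -> vcol u = vcol v ->
  Tsigma sigma X v =
    if arrow (Gsigma sigma) u v then Tsigma sigma X u
    else Tsigma sigma X u + 1.
Proof.
move=> er ec; rewrite !ffunE -(down_arrowE _ er ec).
have um : (vrow u <= m.-1)%N by rewrite -ltnS (ltn_predK (vrow_lt u)) vrow_lt.
have -> : (m.-1 - vrow v = (m.-1 - vrow u).+1)%N by rewrite er subnSK // -er.
by rewrite /= ec subKn.
Qed.

Lemma connect_monotone (T : finType) (e : rel T) (P : rel T) :
  reflexive P -> transitive P -> (forall x y, e x y -> P x y) ->
  forall x y, connect e x y -> P x y.
Proof.
move=> rP tP eP x y /connectP[p ep ->] {y}.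
elim: p x ep => [|z p IH] x /=; first by [].
by move=> /andP[/eP xz /IH]; apply: tP.
Qed.

(* Along an arrow, either the entry decreases by a positive integer, or it is *)
(* unchanged and the arrow points down or goes right in the top row.          *)
Lemma full_tableau_graph_acyclic (R : realType) (m : nat) (L : tableau R m) :
  antisymmetric (connect (arrow (full_tableau_graph L))).
Proof.
pose P (u v : vertex m) := `[< is_posnat (L u - L v) \/ L u = L v /\
  ((vrow v < vrow u)%N \/ vrow u = vrow v /\ (vcol u <= vcol v)%N) >].
have PP : forall u v, connect (arrow (full_tableau_graph L)) u v -> P u v.
  apply: connect_monotone.
  - by move=> u; apply/asboolP; right; split=> //; right.
  - move=> v u w /asboolP uv /asboolP vw; apply/asboolP.
    have eqD : L u - L w = (L u - L v) + (L v - L w) by rewrite addrA subrK.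
    case: uv vw => [[a ea]|[euv ruv]] [[b eb]|[evw rvw]].
    + by left; exists (a + b.+1)%N; rewrite eqD ea eb -natrD addSn.
    + by left; exists a; rewrite -evw.
    + by left; exists b; rewrite euv.
    + right; split; first by rewrite euv.
      case: ruv rvw => [r1|[r1 c1]] [r2|[r2 c2]].
      * by left; apply: ltn_trans r1.
      * by left; rewrite -r2.
      * by left; rewrite r1.
      * by right; split; [rewrite r1 | apply: leq_trans c2].
  - move=> u v; rewrite /arrow inE => /asboolP H; apply/asboolP.
    have nat0 : is_nat (L u - L v) -> is_posnat (L u - L v) \/ L u = L v.
      by case=> -[|a] ea; [right; apply/subr0_eq | left; exists a].
    case: H => [[er /nat0[]]|[er]|[/eqP tu /eqP tv uv /nat0[]]]; try by left.
      by move=> e; right; split=> //; left; rewrite er.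
    move=> e /(_ e) lt; right; split=> //; right; split; last exact: ltnW.
    by apply: succn_inj; rewrite tu tv.
move=> u v /andP[/PP/asboolP uv /PP/asboolP vu].
have npos (a : nat) (x : R[i]) : x = a.+1%:R -> - x = 0 \/ is_posnat (- x) -> False.
  move=> -> [/eqP|[b /eqP]]; first by rewrite oppr_eq0 pnatr_eq0.
  by rewrite eq_sym -subr_eq0 opprK -natrD pnatr_eq0.
case: uv => [[a ea]|[e1 r1]].
  case: (npos a _ ea); rewrite opprB; case: vu => [|[-> _]]; first by right.
  by left; rewrite subrr.
case: vu => [[a ea]|[_ r2]].
  by case: (npos a _ ea); left; rewrite e1 subrr oppr0.
case: r1 r2 => [r1|[r1 c1]] [r2|[r2 c2]].
- by have := ltn_trans r1 r2; rewrite ltnn.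
- by rewrite r2 ltnn in r1.
- by rewrite r1 ltnn in r2.
- by apply: vertex_eq => //; apply: val_inj; apply/eqP; rewrite eqn_leq c1 c2.
Qed.

Lemma transitive_reduction_ex (m : nat) (G : graph m) :
  exists H, transitive_reduction G H.
Proof.
have [|H HP _] := @minset_exists _ (same_reachability G) G; last by exists H.
by apply/forallP=> u; apply/forallP=> v.
Qed.

Lemma tableau_graphP (R : realType) (m : nat) (L : tableau R m) :
  transitive_reduction (full_tableau_graph L) (tableau_graph L).
Proof.
rewrite /tableau_graph; case: pickP => //= no.
by have [H] := transitive_reduction_ex (full_tableau_graph L); rewrite no.
Qed.

Lemma transitive_reduction_arrow (m : nat) (G H : graph m) :
  antisymmetric (connect (arrow G)) -> transitive_reduction G H ->
  forall u v, arrow H u v =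
    [&& u != v, connect (arrow G) u v &
        [forall w, connect (arrow G) u w && connect (arrow G) w v ==>
                   (w == u) || (w == v)]].
Proof.
move=> aG /minsetP[/forallP sr mn].
have eqc u v : connect (arrow G) u v = connect (arrow H) u v.
  by have /forallP/(_ v)/eqP := sr u.
have aH : antisymmetric (connect (arrow H)).
  by move=> x y; rewrite -!eqc; apply: aG.
have bypass u v : arrow H u v -> connect (arrow (H :\ (u, v))) u v -> False.
  move=> Huv by_; have : H :\ (u, v) = H.
    apply: mn; last exact: subD1set.
    apply/forallP=> x; apply/forallP=> y; rewrite eqc; apply/eqP.
    apply/idP/idP; apply: connect_sub => {}x {}y; last first.
      by rewrite /arrow !inE => /andP[_ xy]; apply: connect1.
    move=> xy; have [[-> ->]|ne] := eqVneq (x, y) (u, v); first exact: by_.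
    by apply: connect1; rewrite /arrow !inE ne.
  by move=> /setP/(_ (u, v)); rewrite !inE eqxx /= => /esym; rewrite -/(arrow H u v) Huv.
have avoid u v x y : connect (arrow H) x y ->
    ~~ (connect (arrow H) x u && connect (arrow H) v y) ->
    connect (arrow (H :\ (u, v))) x y.
  move=> /connectP[p]; elim: p x => [|z p IH] x /=; first by move=> _ ->.
  move=> /andP[xz zp] ey ne.
  have zy : connect (arrow H) z y by apply/connectP; exists p.
  apply: (@connect_trans _ _ z); last first.
    apply: IH => //; apply: contra ne => /andP[zu ->]; rewrite andbT.
    by apply: connect_trans zu; apply: connect1.
  apply: connect1; rewrite /arrow !inE; apply/andP; split=> //.
  by apply: contra ne => /eqP[<- <-]; rewrite connect0.
move=> u v; apply/idP/and3P => [Huv|[uv cuv /forallP btw]].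
  have uv : u != v by apply/eqP=> e; apply: (bypass _ _ Huv); rewrite e.
  split=> //; first by rewrite eqc connect1.
  apply/forallP=> w; apply/implyP; rewrite !eqc => /andP[uw wv].
  apply/norP=> -[wu wv']; apply: (bypass _ _ Huv).
  apply: (@connect_trans _ _ w); apply: avoid => //; apply/negP => /andP[h1 h2].
    by case/eqP: wv'; apply: aH; rewrite wv.
  by case/eqP: wu; apply: aH; rewrite h1.
move: cuv; rewrite eqc => /connectP[[|w p] /=]; first by move=> _ e; rewrite e eqxx in uv.
elim: p w => [|z p IH] w /=; first by rewrite andbT => Huw ->.
move=> /andP[Huw /andP[wz zp]] ev.
have wv : connect (arrow H) w v by apply/connectP; exists (z :: p); rewrite //= wz.
have := btw w; rewrite !eqc (connect1 Huw) wv /= => /orP[] /eqP e; last by rewrite -e.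
by apply: (IH z) => //=; rewrite zp andbT -{1}e.
Qed.

Lemma tableau_graph_uniq (R : realType) (m : nat) (L : tableau R m)
    (H : graph m) :
  transitive_reduction (full_tableau_graph L) H -> H = tableau_graph L.
Proof.
move=> HP; have aG := @full_tableau_graph_acyclic R m L.
apply/setP=> -[u v]; have := transitive_reduction_arrow aG HP u v.
by rewrite -(transitive_reduction_arrow aG (tableau_graphP L)).
Qed.

(* Main.v *)
Require Import Defs.
From HB Require Import structures.
From mathcomp Require Import all_boot all_order all_fingroup all_algebra.
From mathcomp Require Import boolp reals complex.
From mathcomp Require Import finmap archimedean.
From mathcomp.multinomials Require Import monalg.
From mathcomp Require Import ring zify.

(* The entries indexed by A are moved to the last k columns: sigma sends a_i  *)
(* to n - k + tau(i) and the other indices to the first n - k columns. Since  *)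
(* the arrows of G_sigma in these columns only compare elements of A, the     *)
(* upper right corner of T_sigma(bar lambda) is T_tau(bar mu_A). The other    *)
(* columns contain no entry at an integral distance from another column, so   *)
(* the graph of T_sigma(bar lambda) is the graph H of the corner together     *)
(* with components having at most one vertex in each row.                     *)
(*   To carry the relation property from gl_k to gl_n it is turned into a     *)
(* condition on realizations that does not see the additional columns: if two *)
(* entries of a row satisfy L u - L v = 1, then at least two vertices w lie   *)
(* in the row above with L w = L v or in the row below with L w = L u. This   *)
(* is necessary, by [E_(r,r+1), E_(r+1,r)] = E_rr - E_(r+1,r+1) on a          *)
(* realization stretched so that u, v is the only such pair of its row: the   *)
(* diagonal coefficient is a sum of residues of a rational function, in which *)
(* one residue would be missing. It is also sufficient: the generic rational  *)
(* identities behind the relations of the Chevalley generators survive, since *)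
(* the terms dropped with non-realizations vanish, and these relations define *)
(* a gl_n-module.                                                             *)

(** [block_perm] turns a pair (tau, rho) in S_k x S_(n-k) into a permutation of the n indices,
    injectively ([block_perm_inj]), and lambda is a relation weight for it as soon as mu_A is a
    tau-relation weight, whatever rho is ([block_perm_relation]). This yields p (n-k)! permutations.

    The step from the corner graph H to the whole graph G is [relation_graph_corner]. Since the
    Gelfand-Tsetlin coefficients involve the added columns, the modules are not compared;
    [double_zeros] is transported instead. Two entries of a row below the top at distance 1 lie in
    one connected component, hence in the corner, and the zeros found in the corner are zeros in the
    large tableau.

    Necessity ([relation_graph_double_zeros]): on T(L), [E, F] in a given row acts by the sum of the
    residues of the rational function with poles x and x + 1 for x in the row, and zeros y + 1 for y
    in the row above and y for y in the row below. The module axiom says that this sum is the sum of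
    the poles minus the sum of the zeros. For distinct poles this is the residue theorem. A pair
    with L u = L v + 1 gives a double pole; connectivity provides one zero there and the formula
    forces a second.

    Sufficiency ([relation_graph_of_double_zeros]): [residue_sumE] reverses this argument for
    [E, F]. The other Chevalley relations are identities between products of coefficients
    ([gt_coef_comm], [serre_coef]), where the poles at distance 1 are compensated by the double
    zeros ([serre_zero]). Finally [gl_module_of_chevalley] builds the module from the relations. *)

Set Implicit Arguments.
Unset Strict Implicit.
Unset Printing Implicit Defensive.

Import Order.TTheory GRing.Theory Num.Theory.

Local Open Scope ring_scope.

(** * Chevalley generators of gl_m *)

Section Chevalley.

Variables (B : zmodType) (br : B -> B -> B).

Definition lie_bracket : Prop :=
  [/\ forall x y z, br (x + y) z = br x z + br y z,
      forall x y, br y x = - br x y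
    & forall x y z, br x (br y z) = br (br x y) z + br y (br x z)].

(** The Chevalley generators with the Serre relations: [e i], [f i], [h i] stand for E_(i,i+1),
    E_(i+1,i), E_(i,i), and a boolean multiplicity is a Kronecker delta. *)
Definition chevalley (m : nat) (e f h : nat -> B) : Prop :=
  [/\ [/\ forall i j, (i.+1 < m)%N -> (j.+1 < m)%N ->
            br (e i) (f j) = (h i - h i.+1) *+ (i == j),
          forall i j, (i < m)%N -> (j.+1 < m)%N ->
            br (h i) (e j) = e j *+ (i == j) - e j *+ (i == j.+1),
          forall i j, (i < m)%N -> (j.+1 < m)%N ->
            br (h i) (f j) = f j *+ (i == j.+1) - f j *+ (i == j)
        & forall i j, (i < m)%N -> (j < m)%N -> br (h i) (h j) = 0],
      (forall i j, (i.+1 < j)%N -> (j.+1 < m)%N ->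
         br (e i) (e j) = 0 /\ br (f i) (f j) = 0)
    & forall i, (i.+2 < m)%N ->
        [/\ br (e i) (br (e i) (e i.+1)) = 0,
            br (e i.+1) (br (e i.+1) (e i)) = 0,
            br (f i) (br (f i) (f i.+1)) = 0
          & br (f i.+1) (br (f i.+1) (f i)) = 0]].

End Chevalley.

(** The iterated bracket [[e_k, e_(k+1)], ..., e_(k+l)], standing for E_(k,k+l+1). *)
Fixpoint root_vec (B : Type) (br : B -> B -> B) (e : nat -> B) (k l : nat) : B :=
  if l is l'.+1 then br (root_vec br e k l') (e (k + l)%N) else e k.

(* The opposite bracket in the lower triangle makes transposition exchange    *)
(* [e] and [f].                                                               *)
Definition matrix_unit (B : Type) (br : B -> B -> B) (e f h : nat -> B)
    (i j : nat) : B :=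
  if (i < j)%N then root_vec br e i (j - i).-1
  else if (j < i)%N then root_vec (fun x y => br y x) f j (i - j).-1
  else h i.

Section ChevalleyTheory.

Variables (B : zmodType) (br : B -> B -> B).
Hypothesis br_lie : lie_bracket br.
Hypothesis B_reg2 : forall x : B, x + x = 0 -> x = 0.

Lemma brDl x y z : br (x + y) z = br x z + br y z.
Proof. by case: br_lie. Qed.

Lemma brC x y : br y x = - br x y.
Proof. by case: br_lie. Qed.

Lemma br_jacobi x y z : br x (br y z) = br (br x y) z + br y (br x z).
Proof. by case: br_lie. Qed.

Lemma br0l x : br 0 x = 0.
Proof. by apply: (addrI (br 0 x)); rewrite -brDl !addr0. Qed.

Lemma brNl x y : br (- x) y = - br x y.
Proof. by apply: (addrI (br x y)); rewrite -brDl !subrr br0l. Qed.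

Lemma brBl x y z : br (x - y) z = br x z - br y z.
Proof. by rewrite brDl brNl. Qed.

Lemma brDr x y z : br z (x + y) = br z x + br z y.
Proof. by rewrite brC brDl opprD -!brC. Qed.

Lemma br0r x : br x 0 = 0.
Proof. by rewrite brC br0l oppr0. Qed.

Lemma brNr x y : br y (- x) = - br y x.
Proof. by rewrite brC brNl -brC. Qed.

Lemma brBr x y z : br z (x - y) = br z x - br z y.
Proof. by rewrite brDr brNr. Qed.

Lemma brxx x : br x x = 0.
Proof. by apply: B_reg2; rewrite {1}brC addNr. Qed.

Lemma br_mulrbl x y (b : bool) : br (x *+ b) y = br x y *+ b.
Proof. by case: b; rewrite ?mulr1n ?mulr0n ?br0l. Qed.

Lemma br_mulrbr x y (b : bool) : br y (x *+ b) = br y x *+ b.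
Proof. by case: b; rewrite ?mulr1n ?mulr0n ?br0r. Qed.

(** Together with [chevalley_op], this transfers statements about raising root vectors to lowering
    ones. *)
Lemma lie_bracket_op : lie_bracket (fun x y => br y x).
Proof.
split=> [x y z|x y|x y z]; first exact: brDr; first exact: brC.
by rewrite (br_jacobi z y x) [br (br z x) y]brC addrK.
Qed.

Section Positive.

Variables (m : nat) (e f h : nat -> B).
Hypothesis ch : chevalley br m e f h.

Local Notation rv := (root_vec br e).

Lemma root_vec_far (k l i : nat) :
  (k + l.+1 < m)%N -> (i.+1 < m)%N -> (i.+1 < k)%N || (k + l.+1 < i)%N ->
  br (e i) (rv k l) = 0.
Proof.
case: ch => _ com _ klm im.
have ee j : (j.+1 < m)%N -> (i.+1 < j)%N || (j.+1 < i)%N -> br (e i) (e j) = 0.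
  move=> jm /orP[ij|ji]; first by case: (com i j).
  by rewrite brC; case: (com j i) => // -> _; rewrite oppr0.
elim: l klm => [|l IH] klm far /=; first by apply: ee; lia.
by rewrite br_jacobi IH ?ee ?br0l ?br0r ?addr0 //; lia.
Qed.

Lemma root_vec_pred (k l : nat) : (k.+1 + l.+1 < m)%N ->
  br (e k) (rv k.+1 l) = rv k l.+1.
Proof.
case: ch => _ com _; elim: l => [|l IH] klm; first by rewrite /= addn1.
rewrite [rv k.+1 _]/= br_jacobi IH //; last by lia.
have [||-> _] := com k (k.+1 + l.+1)%N; [by lia..|].
by rewrite br0r addr0 /= addSnnS.
Qed.

(** With i = k + l, the part A before the last two generators commutes with e_i, so the bracket
    becomes [A, [e_i, [e_(i-1), e_i]]], which is 0 by a Serre relation. *)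
Lemma root_vec_last (k l : nat) : (k + l.+1 < m)%N ->
  br (e (k + l)%N) (rv k l) = 0.
Proof.
case: ch => _ com serre; case: l => [|[|l]] klm; first by rewrite addn0 brxx.
  have [|_ s _ _] := serre k; first by lia.
  by rewrite /= addn1 [br (e k) _]brC brNr s oppr0.
rewrite /= ; set A := rv k l; set i := (k + l.+2)%N.
have Ai : br (e i) A = 0 by apply: root_vec_far; lia.
have Ai' : br A (e i) = 0 by rewrite brC Ai oppr0.
have -> : br (br A (e (k + l.+1)%N)) (e i) = br A (br (e (k + l.+1)%N) (e i)).
  by rewrite br_jacobi Ai' br0r addr0.
rewrite br_jacobi Ai br0l add0r.
have [|_ s _ _] := serre (k + l.+1)%N; first by lia.
have -> : i = (k + l.+1).+1 by lia.
by rewrite [X in br _ (br _ X)]brC brNr s oppr0 br0r.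
Qed.

(* For [a := [A, e_i]] and [b := [e_i, e_(i+1)]], computing [e_i] against     *)
(* [[A, b]] = [[a, e_(i+1)]] in two ways gives [[a, b]] = - [[a, b]].         *)
Lemma root_vec_penult (k l : nat) : (k + l.+2 < m)%N ->
  br (e (k + l)%N) (rv k l.+1) = 0.
Proof.
case: ch => _ com serre klm; set i := (k + l)%N.
have iE : (k + l.+1)%N = i.+1 by rewrite /i addnS.
have [|s1 _ _ _] := serre i; first by lia.
have last : br (e i) (rv k l) = 0 by apply: root_vec_last; lia.
rewrite [rv k l.+1]/= iE br_jacobi last br0l add0r.
case: l klm @i iE s1 last => [|l] klm i iE s1 last.
  by move: s1; rewrite /i addn0.
rewrite [rv k l.+1]/=; set A := rv k l; set b := br (e i) (e i.+1).
have -> : (k + l.+1)%N = i by [].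
have Ai1 : br A (e i.+1) = 0.
  by rewrite brC root_vec_far ?oppr0 //; lia.
have lastA : br (e i) (br A (e i)) = 0 by [].
set a := br A (e i) in lastA *.
have Ab : br A b = br a (e i.+1) by rewrite /b br_jacobi Ai1 br0r addr0.
have E1 : br (e i) (br A b) = - br a b.
  by rewrite br_jacobi s1 br0r addr0 [br (e i) A]brC brNl.
have E2 : br (e i) (br A b) = br a b.
  by rewrite Ab br_jacobi lastA br0l add0r.
by apply: B_reg2; rewrite -{1}E2 E1 addNr.
Qed.

Lemma root_vec_mid (k l i : nat) : (k + l.+1 < m)%N -> (k <= i <= k + l)%N ->
  br (e i) (rv k l) = 0.
Proof.
elim: l => [|l IH] klm ikl.
  have -> : i = k by lia.
  by rewrite /= brxx.
have [->|ne1] := eqVneq i (k + l.+1)%N; first by apply: root_vec_last.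
have [->|ne2] := eqVneq i (k + l)%N; first by apply: root_vec_penult.
case: ch => _ com _; have [||ee _] := com i (k + l.+1)%N; [by lia..|].
by rewrite /= br_jacobi IH ?ee ?br0l ?br0r ?addr0 //; lia.
Qed.

Lemma root_vec_weight (k l i : nat) : (k + l.+1 < m)%N -> (i < m)%N ->
  br (h i) (rv k l) = rv k l *+ (i == k) - rv k l *+ (i == k + l.+1)%N.
Proof.
case: ch => -[_ he _ _] _ _; elim: l => [|l IH] klm im.
  by rewrite /= he ?addn1 //; lia.
rewrite /= br_jacobi IH; [|lia..]; rewrite he; [|lia..].
rewrite brBl brBr !br_mulrbl !br_mulrbr -!addnS.
by rewrite addrA subrK.
Qed.

Lemma chevalley_op : chevalley (fun x y => br y x) m f e h.
Proof.
case: ch => -[ef he hf hh] com serre; split; first split.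
- by move=> i j im jm; rewrite ef // eq_sym; case: eqP => // ->.
- by move=> i j im jm; rewrite brC hf // opprB.
- by move=> i j im jm; rewrite brC he // opprB.
- by move=> i j im jm; rewrite hh.
- move=> i j ij jm; have [e0 f0] := com i j ij jm.
  by rewrite brC f0 brC e0 oppr0.
- move=> i im; have [s1 s2 s3 s4] := serre i im.
  by split; rewrite brC [X in br _ X]brC brNr opprK.
Qed.

End Positive.

End ChevalleyTheory.

(** * Brackets of matrix units *)

Section MatrixUnits.

Variables (B : zmodType) (br : B -> B -> B).
Hypothesis br_lie : lie_bracket br.
Hypothesis B_reg2 : forall x : B, x + x = 0 -> x = 0.

Let br0l := br0l br_lie.
Let br0r := br0r br_lie.
Let brC := brC br_lie.
Let brBl := brBl br_lie.
Let brNr := brNr br_lie.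
Let br_jacobi := br_jacobi br_lie.

Variables (m : nat) (e f h : nat -> B).
Hypothesis ch : chevalley br m e f h.

Let op_lie := lie_bracket_op br_lie.
Let op_ch := chevalley_op br_lie ch.

Local Notation rv := (root_vec br e).
Local Notation rvf := (root_vec (fun x y => br y x) f).
Local Notation X := (matrix_unit br e f h).

(** [rvf k l] stands for E_(k+l+1,k): only the generators at its two ends act on it, and the one at
    the last index strips the last factor. *)
Lemma raise_neg_root_vec (k l : nat) : (k + l.+1 < m)%N ->
  (forall i, (i.+1 < m)%N -> i != k -> i != (k + l)%N ->
     br (e i) (rvf k l) = 0) /\
  (forall l', l = l'.+1 -> br (e (k + l)%N) (rvf k l) = rvf k l').
Proof.
case: (ch) => -[ef _ _ _] _ _.
elim: l => [|l IH] klm; first split=> // i im ik _.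
  by rewrite /= ef ?(negbTE ik) //; lia.
have {IH}[|IH1 IH2] := IH; first by lia.
split=> [i im ik ikl|_ [<-]].
- rewrite /= br_jacobi ef ?(negbTE ikl) ?br0l ?add0r //; last by lia.
  have [ikl'|ikl'] := eqVneq i (k + l)%N; last by rewrite IH1 ?br0r //; lia.
  case: l klm IH1 IH2 ikl ikl' => [|l] klm _ IH2 _ ikl'; first by lia.
  rewrite ikl' (IH2 l) //.
  have /= F := @root_vec_far _ _ op_lie _ _ _ _ op_ch k l (k + l.+2)%N.
  by rewrite brC F ?oppr0 //; lia.
- rewrite /= br_jacobi ef; [|lia..]; rewrite eqxx mulr1n IH1; [|lia..].
  rewrite br0r addr0 brBl.
  have /= W := @root_vec_weight _ _ op_lie _ _ _ _ op_ch k l.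
  rewrite ![br (h _) _]brC !W; [|lia..].
  have -> : ((k + l.+1)%N == k) = false by lia.
  have -> : ((k + l.+1).+1 == k) = false by lia.
  have -> : ((k + l.+1).+1 == (k + l.+1)%N) = false by lia.
  by rewrite eqxx !mulr0n mulr1n !subr0 sub0r opprK oppr0 subr0.
Qed.

Lemma raise_neg_first (k l : nat) : (k + l.+2 < m)%N ->
  br (e k) (rvf k l.+1) = - rvf k.+1 l.
Proof.
case: (ch) => -[ef _ hf _] _ _.
elim: l => [|l IH] klm.
  rewrite /= br_jacobi !ef; [|lia..]; rewrite eqxx mulr1n.
  have -> : (k == (k + 1)%N) = false by lia.
  rewrite mulr0n br0l add0r brC brBl !hf; [|lia..].
  have -> : (k == (k + 1).+1) = false by lia.
  have -> : (k == (k + 1)%N) = false by lia.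
  have -> : (k.+1 == (k + 1).+1) = false by lia.
  by rewrite addn1 eqxx !mulr0n mulr1n !subr0 !sub0r opprK.
rewrite /= br_jacobi; rewrite /= in IH; rewrite IH; last by lia.
rewrite ef; [|lia..]; have -> : (k == (k + l.+2)%N) = false by lia.
by rewrite mulr0n br0l add0r brNr addSnnS.
Qed.

Lemma matrix_unit_gt k d : X k (k + d.+1)%N = rv k d.
Proof. by rewrite /matrix_unit addnS ltnS leq_addr -addnS addKn. Qed.

Lemma matrix_unit_lt k d : X (k + d.+1)%N k = rvf k d.
Proof.
rewrite /matrix_unit; have -> : (k + d.+1 < k)%N = false by lia.
have -> : (k < k + d.+1)%N by lia.
by rewrite addKn.
Qed.

Lemma matrix_unit_eq k : X k k = h k.
Proof. by rewrite /matrix_unit ltnn. Qed.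

Lemma matrix_unitS k : X k k.+1 = e k.
Proof. by rewrite -addn1 matrix_unit_gt. Qed.

Lemma matrix_unitSl k : X k.+1 k = f k.
Proof. by rewrite -addn1 matrix_unit_lt. Qed.

Lemma raise_matrix_unit i k l : (i.+1 < m)%N -> (k < m)%N -> (l < m)%N ->
  br (e i) (X k l) = X i l *+ (i.+1 == k) - X k i.+1 *+ (i == l).
Proof.
case: (ch) => -[ef he _ _] _ _ im km lm.
have [kl|lk|->] := ltngtP k l.
- have [d dE] : exists d, l = (k + d.+1)%N by exists (l - k).-1; lia.
  rewrite dE in lm kl *; rewrite matrix_unit_gt.
  have [ik|ik] := eqVneq i.+1 k.
    have -> : (i == (k + d.+1)%N) = false by lia.
    by rewrite -ik addSnnS matrix_unit_gt (root_vec_pred br_lie ch) ?subr0 //; lia.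
  have [->|il] := eqVneq i (k + d.+1)%N.
    by rewrite -addnS matrix_unit_gt sub0r /= brC.
  rewrite subr0; have [/andP[ki ik']|far] := boolP (k <= i <= k + d)%N.
    by rewrite (root_vec_mid br_lie B_reg2 ch) //; lia.
  by rewrite (root_vec_far br_lie ch) //; lia.
- have [d dE] : exists d, k = (l + d.+1)%N by exists (k - l).-1; lia.
  rewrite dE in km lk *; rewrite matrix_unit_lt; case: d {dE lk} km => [|d] km.
    rewrite /= ef ?addn1 ?eqSS; [|lia..]; have [->|_] := eqVneq i l.
      by rewrite !matrix_unit_eq.
    by rewrite subr0.
  have [N1 N2] := raise_neg_root_vec km.
  have [il|il] := eqVneq i l.
    have -> : (i.+1 == (l + d.+2)%N) = false by lia.
    by rewrite il raise_neg_first // sub0r -addSnnS matrix_unit_lt.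
  rewrite subr0; have [ik|ik] := eqVneq i.+1 (l + d.+2)%N.
    have {}ik : i = (l + d.+1)%N by lia.
    by rewrite ik (N2 d) // matrix_unit_lt.
  by rewrite N1 //; lia.
- rewrite matrix_unit_eq brC he // opprB [i.+1 == l]eq_sym [i == l]eq_sym.
  by congr (_ - _); case: eqP => // ->; rewrite matrix_unitS.
Qed.

Lemma cartan_matrix_unit i k l : (i < m)%N -> (k < m)%N -> (l < m)%N ->
  br (h i) (X k l) = X i l *+ (i == k) - X k i *+ (i == l).
Proof.
case: (ch) => -[_ _ _ hh] _ _ im km lm.
have [kl|lk|->] := ltngtP k l.
- have [d dE] : exists d, l = (k + d.+1)%N by exists (l - k).-1; lia.
  rewrite dE in lm *; rewrite matrix_unit_gt (root_vec_weight br_lie ch) //.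
  by congr (_ - _); case: eqP => // ->; rewrite matrix_unit_gt.
- have [d dE] : exists d, k = (l + d.+1)%N by exists (k - l).-1; lia.
  rewrite dE in km *; rewrite matrix_unit_lt.
  have /= W := @root_vec_weight _ _ op_lie _ _ _ _ op_ch l d.
  by rewrite brC W // opprB; congr (_ - _); case: eqP => // ->; rewrite matrix_unit_lt.
- rewrite matrix_unit_eq hh //.
  by case: eqP => [->|_]; rewrite ?mulr0n ?subrr // mulr1n matrix_unit_eq subrr.
Qed.

End MatrixUnits.

Lemma matrix_unit_op (B : Type) (br : B -> B -> B) (e f h : nat -> B) i j :
  matrix_unit (fun x y => br y x) f e h i j = matrix_unit br e f h j i.
Proof. by rewrite /matrix_unit; case: ltngtP => // ->. Qed.

Section MatrixUnitBracket.

Variables (B : zmodType) (br : B -> B -> B).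
Hypothesis br_lie : lie_bracket br.
Hypothesis B_reg2 : forall x : B, x + x = 0 -> x = 0.
Variables (m : nat) (e f h : nat -> B).
Hypothesis ch : chevalley br m e f h.

Local Notation X := (matrix_unit br e f h).

Let rel i j := forall k l, (k < m)%N -> (l < m)%N ->
  br (X i j) (X k l) = X i l *+ (j == k) - X k j *+ (i == l).

(** By Jacobi, bracketing with X_ik = [X_ij, X_jk] is the commutator of bracketing with X_ij and
    with X_jk, so the relations against all matrix units pass to X_ik. *)
Let rel_comp i j k : (i < m)%N -> (j < m)%N -> (k < m)%N -> i != k ->
  rel i j -> rel j k -> br (X i j) (X j k) = X i k /\ rel i k.
Proof.
move=> im jm km ik rij rjk.
have E : br (X i j) (X j k) = X i k by rewrite rij // eqxx (negbTE ik) subr0.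
split=> // p q pm qm.
have -> : br (X i k) (X p q) =
    br (X i j) (br (X j k) (X p q)) - br (X j k) (br (X i j) (X p q)).
  by rewrite [X in X - _](br_jacobi br_lie) addrK E.
rewrite (rjk p q) // (rij p q) // !(brBr br_lie) !(br_mulrbr br_lie).
rewrite (rij j q) // (rij p k) // (rjk i q) // (rjk p j) //.
rewrite !eqxx (negbTE ik) [k == i]eq_sym (negbTE ik) !mulr1n !mulr0n !subr0 !sub0r.
case: (k == p); case: (j == q); case: (j == p); case: (i == q) => /=;
  rewrite ?mulr0n ?mulr1n ?subr0 ?sub0r ?oppr0 ?addr0 ?add0r ?opprB ?opprK //;
  rewrite ?subrr ?addNr ?addr0 ?add0r ?oppr0 ?addrA ?subrK //.
- by rewrite addrAC [X in X - _]addrAC !subrK.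
- by rewrite addrAC addNr add0r.
Qed.

(** [rel_comp] climbs from the generators to X_ij along the chain of indices between i and j. *)
Lemma matrix_unit_bracket i j k l :
  (i < m)%N -> (j < m)%N -> (k < m)%N -> (l < m)%N ->
  br (X i j) (X k l) = X i l *+ (j == k) - X k j *+ (i == l).
Proof.
have relS p : (p.+1 < m)%N -> rel p p.+1.
  by move=> pm q r qm rm; rewrite matrix_unitS (raise_matrix_unit br_lie B_reg2 ch).
have relSl p : (p.+1 < m)%N -> rel p.+1 p.
  move=> pm q r qm rm; rewrite matrix_unitSl (brC br_lie).
  have := raise_matrix_unit (lie_bracket_op br_lie) B_reg2 (chevalley_op br_lie ch)
    pm rm qm.
  by rewrite !(matrix_unit_op br e f h) => ->; rewrite opprB.
suff R : (i < m)%N -> (j < m)%N -> rel i j by move=> im jm km lm; apply: R.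
move=> {k l}; have [ij|ji|->] := ltngtP i j => im jm.
- have [d dE] : exists d, j = (i + d.+1)%N by exists (j - i).-1; lia.
  rewrite dE in jm *; elim: d {dE ij} jm => [|d IH] jm.
    by rewrite addn1; apply: relS; lia.
  rewrite (addnS i); have jm' : (i + d.+1 < m)%N by lia.
  have ne : i != (i + d.+1).+1 by lia.
  have Sm : ((i + d.+1).+1 < m)%N by lia.
  by case: (rel_comp im jm' Sm ne (IH jm') (relS _ Sm)).
- have [d dE] : exists d, i = (j + d.+1)%N by exists (i - j).-1; lia.
  rewrite dE in im *; elim: d {dE ji} im => [|d IH] im.
    by rewrite addn1; apply: relSl; lia.
  rewrite (addnS j); have im' : (j + d.+1 < m)%N by lia.
  have ne : (j + d.+1).+1 != j by lia.
  have Sm : ((j + d.+1).+1 < m)%N by lia.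
  by case: (rel_comp Sm im' jm ne (relSl _ Sm) (IH im')).
- by move=> k l km lm; rewrite matrix_unit_eq (cartan_matrix_unit br_lie ch).
Qed.

End MatrixUnitBracket.

(** * Linear endomorphisms, and modules from Chevalley generators *)

Record lin_end (K : fieldType) (V : lmodType K) :=
  LinEnd { lin_fun :> V -> V; lin_endP : linear lin_fun }.

Section LinEnd.

Variables (K : fieldType) (V : lmodType K).
Implicit Types f g : lin_end V.

(** The laws of [lie_bracket] and [chevalley] are equalities in [B], so pointwise equal
    endomorphisms have to be equal as records. *)
Lemma lin_end_ext f g : f =1 g -> f = g.
Proof.
case: f g => [f fP] [g gP] /= /funext fg; case: g / fg gP => gP.
by congr LinEnd; apply: Prop_irrelevance.
Qed.

Lemma lin_endD f u v : f (u + v) = f u + f v.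
Proof. by have := lin_endP f 1 u v; rewrite !scale1r. Qed.

Lemma lin_end0 f : f 0 = 0.
Proof. by apply: (addrI (f 0)); rewrite -lin_endD !addr0. Qed.

Lemma lin_endZ f c u : f (c *: u) = c *: f u.
Proof. by have := lin_endP f c u 0; rewrite !addr0 lin_end0 addr0. Qed.

Lemma lin_endN f u : f (- u) = - f u.
Proof. by rewrite -scaleN1r lin_endZ scaleN1r. Qed.

Lemma lin_endB f u v : f (u - v) = f u - f v.
Proof. by rewrite lin_endD lin_endN. Qed.

Lemma lin_end_sum f (I : Type) (r : seq I) (P : pred I) (F : I -> V) :
  f (\sum_(i <- r | P i) F i) = \sum_(i <- r | P i) f (F i).
Proof. by apply: (big_morph f); [apply: lin_endD | apply: lin_end0]. Qed.

HB.instance Definition _ := gen_eqMixin (lin_end V).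
HB.instance Definition _ := gen_choiceMixin (lin_end V).

Fact lin_end_zero_subproof : linear (fun _ : V => 0 : V).
Proof. by move=> c u v; rewrite scaler0 addr0. Qed.

Fact lin_end_opp_subproof f : linear (fun u => - f u).
Proof. by move=> c u v; rewrite lin_endP opprD scalerN. Qed.

Fact lin_end_add_subproof f g : linear (fun u => f u + g u).
Proof. by move=> c u v; rewrite !lin_endP scalerDr addrACA. Qed.

Fact lin_end_br_subproof f g : linear (fun u => f (g u) - g (f u)).
Proof. by move=> c u v; rewrite !lin_endP scalerBr opprD addrACA. Qed.

Definition lin_end_br f g := LinEnd (lin_end_br_subproof f g).

Let zero := LinEnd lin_end_zero_subproof.
Let opp f := LinEnd (lin_end_opp_subproof f).
Let add f g := LinEnd (lin_end_add_subproof f g).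

Let addA : associative add.
Proof. by move=> f g h; apply: lin_end_ext => u /=; rewrite addrA. Qed.
Let addC : commutative add.
Proof. by move=> f g; apply: lin_end_ext => u /=; rewrite addrC. Qed.
Let add0 : left_id zero add.
Proof. by move=> f; apply: lin_end_ext => u /=; rewrite add0r. Qed.
Let addN : left_inverse zero opp add.
Proof. by move=> f; apply: lin_end_ext => u /=; rewrite addNr. Qed.

HB.instance Definition _ := GRing.isZmodule.Build (lin_end V) addA addC add0 addN.

Lemma lin_end_addE f g u : (f + g) u = f u + g u. Proof. by []. Qed.
Lemma lin_end_oppE f u : (- f) u = - f u. Proof. by []. Qed.
Lemma lin_end_mulrbE f (b : bool) u : (f *+ b) u = f u *+ b.
Proof. by case: b. Qed.

Lemma lin_end_lie : lie_bracket lin_end_br.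
Proof.
split=> [f g h|f g|f g h]; apply: lin_end_ext => u /=.
- by rewrite lin_endD opprD addrACA.
- by rewrite opprB.
- rewrite !lin_endB !opprB !addrA.
  by rewrite [RHS](ACl (1*8*3*6*2*5*4*7)%AC) /= !subrK.
Qed.

(** The action extends E_ij -> X_ij linearly, and [matrix_unit_bracket] makes it compatible with
    commutators. That 2 is invertible serves [brxx] and [root_vec_penult]. *)
Lemma gl_module_of_chevalley (m : nat) (e f h : nat -> lin_end V) :
  (2%:R : K) != 0 -> chevalley (@lin_end_br) m e f h ->
  exists rho : 'M[K]_m -> V -> V,
  [/\ gl_module rho,
      forall i j : 'I_m, j = i.+1 :> nat -> rho (delta_mx i j) =1 e i,
      forall i j : 'I_m, j = i.+1 :> nat -> rho (delta_mx j i) =1 f i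
    & forall i : 'I_m, rho (delta_mx i i) =1 h i].
Proof.
move=> nz2 ch; pose X := matrix_unit (@lin_end_br) e f h.
have reg2 (g : lin_end V) : g + g = 0 -> g = 0.
  move=> gg; apply: lin_end_ext => u; have : (g + g) u = 0 by rewrite gg.
  rewrite lin_end_addE -mulr2n -scaler_nat => /eqP.
  by rewrite scaler_eq0 (negbTE nz2) => /eqP.
have XX := matrix_unit_bracket lin_end_lie reg2 ch.
pose rho (A : 'M[K]_m) (u : V) : V := \sum_i \sum_j A i j *: X i j u.
have rhoD (i j : 'I_m) u : rho (delta_mx i j) u = X i j u.
  rewrite /rho (bigD1 i) //= [X in _ + X]big1 ?addr0 => [|p pi]; last first.
    by rewrite big1 // => q _; rewrite mxE (negbTE pi) scale0r.
  rewrite (bigD1 j) //= big1 ?addr0 => [|q qj]; last first.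
    by rewrite mxE (negbTE qj) andbF scale0r.
  by rewrite mxE !eqxx scale1r.
exists rho; split; first split.
- move=> A c u v; rewrite /rho scaler_sumr -big_split; apply: eq_bigr => i _.
  rewrite scaler_sumr -big_split; apply: eq_bigr => j _ /=.
  by rewrite lin_endP scalerDr !scalerA mulrC.
- move=> c A B u; rewrite /rho scaler_sumr -big_split; apply: eq_bigr => i _.
  rewrite scaler_sumr -big_split; apply: eq_bigr => j _ /=.
  by rewrite !mxE scalerDl scalerA.
- move=> A B u.
  have comp (P Q : 'M[K]_m) : rho P (rho Q u) =
      \sum_i \sum_j \sum_k \sum_l (P i j * Q k l) *: X i j (X k l u).
    rewrite /rho; apply: eq_bigr => i _; apply: eq_bigr => j _.
    rewrite lin_end_sum scaler_sumr; apply: eq_bigr => k _.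
    rewrite lin_end_sum scaler_sumr; apply: eq_bigr => l _.
    by rewrite lin_endZ scalerA.
  (* The sums are reordered so that the indices of [A] come first in both products, which can then
     be subtracted termwise. *)
  have comp' : rho B (rho A u) =
      \sum_i \sum_j \sum_k \sum_l (A i j * B k l) *: X k l (X i j u).
    rewrite comp pair_bigA [RHS]pair_bigA /=.
    under eq_bigr do rewrite pair_bigA /=.
    under [RHS]eq_bigr do rewrite pair_bigA /=.
    rewrite exchange_big /=; apply: eq_bigr => p _; apply: eq_bigr => q _.
    by rewrite mulrC.
  rewrite comp comp' -sumrB.
  transitivity (\sum_i \sum_j \sum_k \sum_l (A i j * B k l) *:
      (X i l u *+ (j == k) - X k j u *+ (i == l))); last first.
    apply: eq_bigr => i _; rewrite -sumrB; apply: eq_bigr => j _.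
    rewrite -sumrB; apply: eq_bigr => k _; rewrite -sumrB; apply: eq_bigr => l _.
    rewrite -scalerBr; congr (_ *: _).
    have := XX i j k l (ltn_ord i) (ltn_ord j) (ltn_ord k) (ltn_ord l).
    move=> /(congr1 (fun g : lin_end V => g u)) /= ->.
    by rewrite !lin_end_mulrbE.
  transitivity (rho (A *m B) u - rho (B *m A) u).
    rewrite /rho -sumrB; apply: eq_bigr => i _; rewrite -sumrB; apply: eq_bigr => j _.
    by rewrite !mxE scalerBl.
  under [RHS]eq_bigr => i _ do under eq_bigr => j _ do under eq_bigr => k _ do
    under eq_bigr => l _ do rewrite scalerBr.
  under [RHS]eq_bigr => i _ do under eq_bigr => j _ do under eq_bigr => k _ do
    rewrite sumrB.
  under [RHS]eq_bigr => i _ do under eq_bigr => j _ do rewrite sumrB.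
  under [RHS]eq_bigr => i _ do rewrite sumrB.
  rewrite sumrB; congr (_ - _).
    rewrite /rho; apply: eq_bigr => i _.
    under eq_bigr => l _ do rewrite mxE scaler_suml.
    rewrite exchange_big /=; apply: eq_bigr => j _.
    rewrite [RHS](bigD1 j) //= [X in _ + X]big1 ?addr0 => [|k kj]; last first.
      by apply: big1 => l _; rewrite eq_sym (negbTE kj) scaler0.
    by apply: eq_bigr => l _; rewrite eqxx.
  rewrite /rho.
  under eq_bigr => k _ do under eq_bigr => j _ do rewrite mxE scaler_suml.
  rewrite [RHS]exchange_big /=.
  under [RHS]eq_bigr => j _ do rewrite exchange_big /=.
  rewrite exchange_big /=; apply: eq_bigr => j _; apply: eq_bigr => k _.
  apply: eq_bigr => i _.
  rewrite [RHS](bigD1 i) //= big1 ?addr0 => [|l li]; last first.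
    by rewrite eq_sym (negbTE li) scaler0.
  by rewrite eqxx mulrC.
- by move=> i j ij u; rewrite rhoD /X ij matrix_unitS.
- by move=> i j ij u; rewrite rhoD /X ij matrix_unitSl.
- by move=> i u; rewrite rhoD /X matrix_unit_eq.
Qed.

End LinEnd.

(** * Sums of residues *)

Section ResidueSum.

Variable F : fieldType.
Implicit Types (d s : seq F) (t : F).

(* The residue at a simple pole [t] of the rational function with zeros [s]   *)
(* and poles [d]; it is 0 at a multiple pole, because 1 / 0 = 0.              *)
Definition residue d s t : F :=
  (\prod_(r <- s) (t - r)) / (\prod_(r <- rem t d) (t - r)).

Definition residue_sum d s : F := \sum_(t <- d) residue d s t.

Lemma perm_rem d d' t : perm_eq d d' -> perm_eq (rem t d) (rem t d').
Proof.
move=> dd'; have [td|td] := boolP (t \in d); last first.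
  by rewrite !rem_id // -?(perm_mem dd').
have td' : t \in d' by rewrite -(perm_mem dd').
rewrite -(perm_cons t); apply: perm_trans (perm_to_rem td').
by rewrite perm_sym; apply: perm_trans (perm_to_rem td); rewrite perm_sym.
Qed.

Lemma residue_perm d d' s s' t : perm_eq d d' -> perm_eq s s' ->
  residue d s t = residue d' s' t.
Proof.
move=> dd' ss'; rewrite /residue (perm_big _ ss'); congr (_ / _).
exact: (perm_big _ (perm_rem t dd')).
Qed.

Lemma residue_sum_perm d d' s s' : perm_eq d d' -> perm_eq s s' ->
  residue_sum d s = residue_sum d' s'.
Proof.
move=> dd' ss'; rewrite /residue_sum (perm_big _ dd'); apply: eq_bigr => t _.
exact: residue_perm.
Qed.

Lemma residue_multiple d s t : t \in rem t d -> residue d s t = 0.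
Proof. by move=> td; rewrite /residue (big_rem t td) /= subrr mul0r invr0 mulr0. Qed.

Lemma residue_root d s t : t \in s -> residue d s t = 0.
Proof. by move=> ts; rewrite /residue (big_rem t ts) /= subrr !mul0r. Qed.

(** A factor common to numerator and denominator cancels in every residue away from [t], while the
    residue at the now repeated pole [t] is 0 by the convention 1 / 0 = 0. *)
Lemma residue_sum_cons d s t : t \in d ->
  residue_sum (t :: d) (t :: s) = \sum_(r <- d | r != t) residue d s r.
Proof.
move=> td; rewrite /residue_sum big_cons residue_multiple ?add0r; last first.
  by rewrite /= eqxx.
rewrite [RHS]big_mkcond; apply: eq_bigr => r _.
have [->|rt] := eqVneq r t; first by rewrite residue_multiple //= eqxx.
rewrite /residue big_cons /= eq_sym (negbTE rt) big_cons -mulf_div.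
by rewrite divff ?mul1r // subr_eq0.
Qed.

(** The residue theorem for P / Q, both monic of the same degree: the difference P - Q equals its
    Lagrange interpolation at the poles, and the coefficients just below the top degree are
    compared. *)
Lemma residue_sum_uniq d s : uniq d -> size s = size d ->
  residue_sum d s = \sum_(t <- d) t - \sum_(t <- s) t.
Proof.
move=> ud; case: d ud => [|t0 d0]; first by move=> _ /size0nil ->; rewrite /residue_sum !big_nil subrr.
set d := t0 :: d0 => ud sd.
pose n := size d0.
pose q : {poly F} := \prod_(r <- s) ('X - r%:P) - \prod_(t <- d) ('X - t%:P).
pose D t := \prod_(r <- rem t d) (t - r).
pose l : {poly F} := \sum_(t <- d) (q.[t] / D t) *: \prod_(r <- rem t d) ('X - r%:P).
have sz (e : seq F) : size (\prod_(r <- e) ('X - r%:P)) = (size e).+1.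
  exact: size_prod_XsubC.
have qd t : t \in d -> q.[t] = \prod_(r <- s) (t - r).
  move=> td; rewrite /q hornerD hornerN !horner_prod [X in _ - X](big_rem t) //=.
  rewrite hornerXsubC subrr mul0r oppr0 addr0.
  by apply: eq_bigr => r _; rewrite !hornerE.
have Dn0 t : t \in d -> D t != 0.
  move=> td; rewrite /D prodf_seq_neq0; apply/allP => r; rewrite mem_rem_uniq // inE.
  by move=> /andP[rt _]; rewrite /= subr_eq0 eq_sym.
have ql : q = l.
  apply/eqP; rewrite -subr_eq0; apply/eqP.
  apply: (@roots_geq_poly_eq0 _ _ d) => //.
    apply/allP => t td; rewrite /root hornerD hornerN /l horner_sum (bigD1_seq t) //=.
    rewrite hornerZ horner_prod.
    have -> : \prod_(r <- rem t d) ('X - r%:P).[t] = D t.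
      by apply: eq_bigr => r _; rewrite !hornerE.
    rewrite divfK ?Dn0 // big1_seq ?addr0 ?subrr // => r /andP[rt rd].
    have tr : t \in rem r d by rewrite mem_rem_uniq // inE eq_sym rt.
    rewrite hornerZ horner_prod (big_rem t tr) /=.
    by rewrite hornerXsubC subrr mul0r mulr0.
  have lt1 : (size q <= size d)%N.
    have mon (e : seq F) : size e = size d -> (\prod_(r <- e) ('X - r%:P))`_(size d) = 1.
      move=> ed; have /monicP := monic_prod_XsubC e predT id.
      by rewrite lead_coefE sz ed.
    apply/leq_sizeP => i; rewrite leq_eqVlt => /orP[/eqP <-|di].
      by rewrite coefB !mon ?subrr.
    by rewrite coefB !nth_default ?subrr // sz ?sd.
  rewrite (leq_trans (size_polyD _ _)) // geq_max lt1 size_polyN.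
  apply: (leq_trans (size_sum _ _ _)); apply/bigmax_leqP_seq => t td _.
  by rewrite (leq_trans (size_scale_leq _ _)) // sz size_rem.
have := congr1 (fun p : {poly F} => p`_n) ql.
rewrite /l coef_sum.
under eq_big_seq => t td.
  rewrite coefZ.
  have -> : (\prod_(r <- rem t d) ('X - r%:P))`_n = 1.
    have : \prod_(r <- rem t d) ('X - r%:P) \is monic by apply: monic_prod_XsubC.
    by move=> /monicP; rewrite lead_coefE sz size_rem //.
  rewrite mulr1 qd //.
  over.
rewrite coefB.
have -> : (\prod_(r <- s) ('X - r%:P))`_n = - \sum_(r <- s) r.
  by have := @coefPn_prod_XsubC _ s; rewrite sd; apply.
have -> : (\prod_(r <- d) ('X - r%:P))`_n = - \sum_(r <- d) r.
  exact: (@coefPn_prod_XsubC _ d).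
by rewrite opprK addrC => ->.
Qed.

(** As long as a pole is repeated, one copy of it is cancelled against a zero; distinct poles
    remain. *)
Lemma residue_sumE d s : size s = size d ->
  (forall t, (1 < count_mem t d)%N -> (count_mem t d <= count_mem t s)%N) ->
  residue_sum d s = \sum_(t <- d) t - \sum_(t <- s) t.
Proof.
have [k] := ubnP (size d); elim: k d s => // k IH d s dk sd mult.
have [ud|nud] := boolP (uniq d); first exact: residue_sum_uniq.
have [t t2] : exists t, (1 < count_mem t d)%N.
  apply: contrapT => no; case/negP: nud; apply: count_mem_uniq => t.
  have : ~~ (1 < count_mem t d)%N by apply/negP => t2; apply: no; exists t.
  by rewrite -has_pred1 has_count; case: count => [|[]].
have td : t \in d by rewrite -has_pred1 has_count; lia.
have ts : t \in s by rewrite -has_pred1 has_count; have := mult t t2; lia.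
have pd := perm_to_rem td; have ps := perm_to_rem ts.
have cd := seq.permP pd; have cs := seq.permP ps.
have cdt : count_mem t d = (count_mem t (rem t d)).+1 by rewrite cd /= eqxx.
have cst : count_mem t s = (count_mem t (rem t s)).+1 by rewrite cs /= eqxx.
have multt := mult t t2.
have td' : t \in rem t d by rewrite -has_pred1 has_count; lia.
have ts' : t \in rem t s by rewrite -has_pred1 has_count; lia.
rewrite (residue_sum_perm pd ps) residue_sum_cons //.
(* The residue at [t] may be added back: [t] is still a zero after one copy is removed. *)
have -> : \sum_(r <- rem t d | r != t) residue (rem t d) (rem t s) r =
    residue_sum (rem t d) (rem t s).
  rewrite /residue_sum [RHS](bigID (fun r => r != t)) /= [X in _ = _ + X]big1 ?addr0 //.
  by move=> r /negPn/eqP ->; apply: residue_root.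
rewrite IH.
- rewrite [in RHS](perm_big _ pd) [in RHS](perm_big _ ps) !big_cons /=.
  by rewrite opprD addrACA subrr add0r.
- by rewrite size_rem //; case: (d) td dk.
- by rewrite !size_rem // sd.
- move=> r; have := mult r; rewrite (cd (pred1 r)) (cs (pred1 r)) /=.
  have [<-|_] := eqVneq t r; last by rewrite !add0n.
  by rewrite !add1n => m1 m2; rewrite -ltnS m1 // ltnW.
Qed.


(** Cancelling one zero against the double pole discards the residue at [t], so the residue formula
    can hold only if that residue is 0, that is, if [t] is a zero once more. *)
Lemma residue_sum_double_pole d s t : t \in d -> uniq d -> size s = size d ->
  residue_sum (t :: d) (t :: s) = \sum_(r <- d) r - \sum_(r <- s) r -> t \in s.
Proof.
move=> td ud sd; rewrite residue_sum_cons // -(residue_sum_uniq ud sd) => E.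
apply: contraT => ts; have /eqP : residue d s t = 0.
  move: E; rewrite /residue_sum [RHS](bigD1_seq t) //=.
  move=> /(congr1 (fun x => x - \sum_(r <- d | r != t) residue d s r)).
  by rewrite subrr addrK => <-.
rewrite mulf_eq0 invr_eq0 !prodf_seq_eq0 /= => /orP[] /hasP[r rs];
  rewrite subr_eq0 => /eqP tr; first by rewrite tr rs in ts.
by rewrite -tr mem_rem_uniq // inE eqxx in rs.
Qed.

End ResidueSum.

(** * Realizations *)

(* Raising ([e = true]) and lowering ([e = false]) are treated together:      *)
(* [nb e v] is the row whose entries form the numerator of the coefficient of *)
(* [T (L +/- delta v)].                                                       *)
Definition sg (R : realType) (e : bool) : R[i] := if e then 1 else -1.
Arguments sg {R}.

Definition nb (m : nat) (e : bool) (v w : vertex m) : bool :=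
  if e then vrow w == (vrow v).+1 else (vrow w).+1 == vrow v.

Definition gt_coef (R : realType) (m : nat) (e : bool) (L : tableau R m)
    (v : vertex m) : R[i] :=
  (\prod_(w | nb e v w) (L v - L w)) /
  (\prod_(w | (vrow w == vrow v) && (w != v)) (L v - L w)).

Section Realization.

Variables (R : realType) (m : nat) (G : graph m).
Implicit Types (L : tableau R m) (u v w : vertex m) (e : bool).

Lemma sgE e : sg e = (if e then 1 else -1 : int)%:~R :> R[i].
Proof. by case: e; rewrite /sg ?rmorphN rmorph1. Qed.

Lemma sgN e : sg (~~ e) = - sg e :> R[i].
Proof. by case: e; rewrite /sg /= ?opprK. Qed.

Lemma sg_neq0 e : sg e != 0 :> R[i].
Proof. by case: e; rewrite /sg ?oppr_eq0 oner_eq0. Qed.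

Lemma nbN e v w : nb (~~ e) v w = nb e w v.
Proof. by case: e; rewrite /nb /= eq_sym. Qed.

Lemma nb_neq e v w : nb e v w -> w != v.
Proof.
by case: e; rewrite /nb => h; apply/eqP => wv; move: h; rewrite wv; lia.
Qed.

Lemma nb_row_neq e v w : nb e v w -> (vrow w == vrow v) = false.
Proof. by case: e; rewrite /nb; lia. Qed.

Lemma shift_entryE L v c w : shift_entry L v c w = L w + c *+ (w == v).
Proof. by rewrite ffunE; case: eqP; rewrite ?addr0. Qed.

Lemma shift_entryC L v w c d :
  shift_entry (shift_entry L v c) w d = shift_entry (shift_entry L w d) v c.
Proof. by apply/ffunP => x; rewrite !shift_entryE addrAC. Qed.

Lemma shift_entryK L v c : shift_entry (shift_entry L v c) v (- c) = L.
Proof.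
by apply/ffunP => x; rewrite !shift_entryE; case: eqP => _; rewrite ?addr0 ?addrK.
Qed.

Lemma satisfiesP L : satisfies G L <->
  forall u v, arrow G u v -> exists2 z : int, L u - L v = z%:~R &
    (vrow v == (vrow u).+1 : nat)%:Z <= z.
Proof.
split=> S u v uv; have := S u v uv.
  by case: ifP => _ [n ->]; [exists n.+1%:Z | exists n%:Z]; rewrite -?pmulrn.
case=> z ->; case: ifP => _; case: z => [n|n] //; last by exists n.
by case: n => // n; exists n.
Qed.

(* Adding integers [g] keeps every difference of entries in its class modulo  *)
(* the integers, so only the inequalities have to be checked.                 *)
Lemma realization_shift L L' (g : vertex m -> int) :
  (forall v, L' v = L v + (g v)%:~R) -> realization G L ->
  (forall u v z, arrow G u v -> L u - L v = z%:~R ->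
     (vrow v == (vrow u).+1 : nat)%:Z <= z ->
     (vrow v == (vrow u).+1 : nat)%:Z <= z + g u - g v) ->
  realization G L'.
Proof.
move=> L'E [/satisfiesP sat comp] H; split.
  apply/satisfiesP => u v uv; have [z zE zge] := sat u v uv.
  exists (z + g u - g v); last exact: H.
  by rewrite !L'E intrB intrD -zE; ring.
move=> u v ruv tu [z zE]; apply: comp => //; exists (z - g u + g v).
by rewrite intrD intrB -zE !L'E; ring.
Qed.

Lemma realization_gap L u v : realization G L -> arrow G u v ->
  exists2 z : int, L u - L v = z%:~R & (vrow v == (vrow u).+1 : nat)%:Z <= z.
Proof. by move=> [/satisfiesP sat _]; apply: sat. Qed.

Lemma gt_coef_eq0 e L v w : nb e v w -> L v = L w -> gt_coef e L v = 0.
Proof.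
by move=> vw E; rewrite /gt_coef (bigD1 w) //= E subrr !mul0r.
Qed.

(** In direction [e], [w] is strictly ahead of [v] in every realization. A move of [v] onto [w]
    leaves the realizations, but then [v] makes the coefficient of a move of [w] vanish. *)
Definition blocks e w v : Prop :=
  nb e w v /\ forall L, realization G L -> exists n : nat, L w - L v = sg e * n.+1%:R.

Lemma gap_gt0 L (z : int) u v : L u - L v = z%:~R -> 1 <= z ->
  exists n : nat, L u - L v = n.+1%:R.
Proof. by case: z => [[|n]|n] // -> _; exists n. Qed.

Hypothesis adm : admissible G.

(** A move of [v] breaks only a tight inequality of an arrow at [v]. If the arrow points down, the
    two entries are equal and [w] is a zero of the coefficient; if it points up, the other end
    blocks [v]. *)
Lemma realization_exit e L v : realization G L -> ~~ top v ->
  ~ realization G (shift_entry L v (sg e)) ->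
  (exists2 w, nb e v w & L w = L v) \/
  (exists2 w, blocks e w v & L w = L v + sg e).
Proof.
move=> real tv nreal; apply: contrapT => /not_orP[no1 no2]; apply: nreal.
have vL : forall x, shift_entry L v (sg e) x =
    L x + ((if e then 1 else -1) *+ (x == v))%:~R.
  by move=> x; rewrite shift_entryE sgE; case: eqP.
apply: (realization_shift vL real) => u u' z uu' zE zge.
have := (proj1 adm) u u' uu'.
have [ev|nuv] := eqVneq u v; have [ev'|nuv'] := eqVneq u' v.
- by rewrite addrK.
- subst u; rewrite mulr1n mulr0n subr0; case: e vL no1 no2 => vL no1 no2 adj.
    by rewrite (le_trans zge) // lerDl.
  have {adj}/orP[/eqP dn|/eqP up] : (vrow v == (vrow u').+1) || (vrow u' == (vrow v).+1).
    by move: adj; rewrite (negbTE tv) /= orbF.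
  + have ndn : (vrow u' == (vrow v).+1) = false by lia.
    rewrite ndn in zge *; have [z0|] := eqVneq z 0; last by lia.
    case: no1; exists u'; first by rewrite /nb dn.
    by apply/esym/eqP; rewrite -subr_eq0 zE z0.
  + rewrite up eqxx in zge *; have [z1|] := eqVneq z 1; last by lia.
    case: no2; exists u'.
      split; first by rewrite /nb up.
      move=> L' real'; have [y yE] := realization_gap real' uu'.
      rewrite up eqxx => /(gap_gt0 yE)[n nE]; exists n.
      by rewrite /sg -opprB nE mulN1r.
    by rewrite -[L u'](subKr (L v)) zE z1.
- subst u'; rewrite mulr1n mulr0n addr0; case: e vL no1 no2 => vL no1 no2 adj; last first.
    by rewrite opprK (le_trans zge) // lerDl.
  have {adj}/orP[/eqP dn|/eqP up] : (vrow u == (vrow v).+1) || (vrow v == (vrow u).+1).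
    by move: adj; rewrite (negbTE tv) /= andbF orbF.
  + have ndn : (vrow v == (vrow u).+1) = false by lia.
    rewrite ndn in zge *; have [z0|] := eqVneq z 0; last by lia.
    case: no1; exists u; first by rewrite /nb dn.
    by apply/eqP; rewrite -subr_eq0 zE z0.
  + rewrite up eqxx in zge *; have [z1|] := eqVneq z 1; last by lia.
    case: no2; exists u.
      split; first by rewrite /nb up.
      move=> L' real'; have [y yE] := realization_gap real' uu'.
      rewrite up eqxx => /(gap_gt0 yE)[n nE]; exists n.
      by rewrite /sg nE mul1r.
    by rewrite -[L u](subrK (L v)) zE z1 addrC.
- by rewrite !mulr0n addr0 subr0.
Qed.

End Realization.

(** When L u = L v + 1, the two moves that make these entries collide are raising [v] and lowering
    [u]; the set collects the vanishing numerator factors of both. *)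
Definition zero_set (R : realType) (m : nat) (L : tableau R m) (u v : vertex m) :
    {set vertex m} :=
  [set w | (vrow w == (vrow u).+1) && (L w == L v)
        || ((vrow w).+1 == vrow u) && (L w == L u)].

(* The two factors of the denominator that vanish when [L u] meets [L v] are  *)
(* compensated by two vanishing factors of the numerator.                     *)
Definition double_zeros (R : realType) (m : nat) (G : graph m) : Prop :=
  forall (L : tableau R m) u v, realization G L -> vrow u = vrow v -> ~~ top u ->
    L u - L v = 1 -> (1 < #|zero_set L u v|)%N.

(** * Sequences of moves between realizations *)

Section Moves.

Variables (R : realType) (m : nat) (G : graph m).
Implicit Types (L : tableau R m) (u v w : vertex m) (e : bool).

Local Notation eps e := (if e then 1 else -1 : int).

(** After the first move, the gap of an arrow is its initial or its final gap unless the arrow joins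
    [v] and [w]; in that case opposite moves change the gap in the same direction, and the
    intermediate value lies between the two. *)
Lemma realization_between e e' L v w : v != w -> realization G L ->
  realization G (shift_entry (shift_entry L v (sg e)) w (sg e')) ->
  e' = ~~ e \/ ~~ arrow G v w && ~~ arrow G w v ->
  realization G (shift_entry L v (sg e)).
Proof.
move=> vw real realF C.
have vL x : shift_entry L v (sg e) x = L x + (eps e *+ (x == v))%:~R.
  by rewrite shift_entryE sgE; case: eqP.
apply: (realization_shift vL real) => u u' z uu' zE zge.
have [y yE] := realization_gap realF uu'.
have {yE} -> : y = z + eps e *+ (u == v) + eps e' *+ (u == w)
    - (eps e *+ (u' == v) + eps e' *+ (u' == w)).
  apply: (@intr_inj R[i]); rewrite -yE !shift_entryE !sgE.
  rewrite intrB !intrD -zE; case: (u == v) (u == w) (u' == v) (u' == w);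
    by do 3! case; rewrite ?mulr1n ?mulr0n; ring.
have vw' : v <> w by apply/eqP.
have [uv|_] := eqVneq u v; have [u'v|_] := eqVneq u' v;
have [uw|_] := eqVneq u w; have [u'w|_] := eqVneq u' w;
  rewrite ?mulr1n ?mulr0n; try by [case: vw'; congruence | case: (e); lia | lia];
  case: C => [->|/andP[na na']]; try (by case: (e) => /=; lia);
  by [rewrite -uv -u'w uu' in na | rewrite -uw -u'v uu' in na'].
Qed.

Lemma shift_entriesE e L (l : seq (vertex m)) x :
  foldl (fun M v => shift_entry M v (sg e)) L l x = L x + sg e *+ count_mem x l.
Proof.
elim: l L => [|v l IH] L /=; first by rewrite addr0.
by rewrite IH shift_entryE -addrA -mulrnDr eq_sym.
Qed.

(** [w] is level with [v] at the start and strictly ahead at the end, while all moves have the same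
    direction. *)
Lemma blocks_count e w v L (l : seq (vertex m)) : blocks R G e w v ->
  realization G (foldl (fun M x => shift_entry M x (sg e)) L l) -> L w = L v ->
  (count_mem v l < count_mem w l)%N.
Proof.
move=> [_ blk] /blk[n]; rewrite !shift_entriesE => + Lwv.
rewrite Lwv opprD addrACA subrr add0r -![sg e *+ _]mulr_natr -mulrBr => /(mulfI (sg_neq0 _ e)) /eqP.
by rewrite subr_eq -natrD eqr_nat => /eqP ->; rewrite addSn ltnS leq_addl.
Qed.

Hypothesis adm : admissible G.

(* Coefficients at non-realizations may have a vanishing denominator; because *)
(* 1 / 0 = 0, a path that leaves the realizations and comes back still        *)
(* contributes 0, so the dropped summands need not be tracked.                *)
Lemma gt_coef_detour3 e L v1 v2 v3 :
  ~~ top v1 -> ~~ top v2 -> realization G L ->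
  realization G (shift_entry (shift_entry (shift_entry L v1 (sg e)) v2 (sg e)) v3 (sg e)) ->
  let M1 := shift_entry L v1 (sg e) in
  let M2 := shift_entry M1 v2 (sg e) in
  ~ (realization G M1 /\ realization G M2) ->
  gt_coef e L v1 * gt_coef e M1 v2 * gt_coef e M2 v3 = 0.
Proof.
move=> t1 t2 real realF M1 M2 out.
have [real1|nreal1] := pselect (realization G M1); last first.
  have [[w vw Lw]|[w wb Lw]] := realization_exit adm real t1 nreal1.
    by rewrite (gt_coef_eq0 vw (esym Lw)) !mul0r.
  have M1w : M1 w = M1 v1.
    by rewrite !shift_entryE eqxx [w == v1]eq_sym (negbTE (nb_neq (proj1 wb))) Lw addr0.
  (* [w] has to move more often than [v1] in the remaining steps; when it first does so, its entry
     equals that of [v1] and its coefficient is 0. *)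
  have := blocks_count (l := [:: v2; v3]) wb realF M1w.
  rewrite /= !addn0; have [wv2|wv2] := eqVneq v2 w.
    by rewrite [gt_coef e M1 _](gt_coef_eq0 (w := v1)) ?mulr0 ?mul0r ?wv2 //; case: wb.
  have [wv3|//] := eqVneq v3 w; have [|v12 _] := eqVneq v2 v1; first by case: eqVneq.
  rewrite [gt_coef e M2 _](gt_coef_eq0 (w := v1)) ?mulr0 ?wv3 //; first by case: wb.
  by rewrite !(shift_entryE M1) M1w ![_ == v2]eq_sym (negbTE wv2) (negbTE v12).
have nreal2 : ~ realization G M2 by move=> real2; apply: out.
have [[w vw Lw]|[w wb Lw]] := realization_exit adm real1 t2 nreal2.
  by rewrite (gt_coef_eq0 vw (esym Lw)) mulr0 mul0r.
have M2w : M2 w = M2 v2.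
  by rewrite !(shift_entryE M1) eqxx [w == v2]eq_sym (negbTE (nb_neq (proj1 wb))) Lw addr0.
have := blocks_count (l := [:: v3]) wb realF M2w.
rewrite /= !addn0; have [wv3 _|//] := eqVneq v3 w.
by rewrite [gt_coef e M2 _](gt_coef_eq0 (w := v2)) ?mulr0 ?wv3 //; case: wb.
Qed.

Lemma connect_gap L u v : realization G L -> connect (arrow G) u v ->
  is_posnat (L u - L v) \/ L u = L v /\
    ((vrow v < vrow u)%N \/ vrow u = vrow v /\ (u == v \/ top u)).
Proof.
move=> real; pose P (u v : vertex m) := `[< is_posnat (L u - L v) \/ L u = L v /\
    ((vrow v < vrow u)%N \/ vrow u = vrow v /\ (u == v \/ top u)) >].
suff PP : forall u v, connect (arrow G) u v -> P u v by move=> /PP/asboolP.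
apply: connect_monotone.
- by move=> x; apply/asboolP; right; split=> //; right; split=> //; left.
- move=> y x z /asboolP xy /asboolP yz; apply/asboolP.
  have eqD : L x - L z = (L x - L y) + (L y - L z) by rewrite addrA subrK.
  case: xy yz => [[a ea]|[exy rxy]] [[b eb]|[eyz ryz]].
  + by left; exists (a + b.+1)%N; rewrite eqD ea eb -natrD addSn.
  + by left; exists a; rewrite -eyz.
  + by left; exists b; rewrite exy.
  + right; split; first by rewrite exy.
    case: rxy ryz => [r1|[r1 c1]] [r2|[r2 c2]].
    * by left; apply: ltn_trans r1.
    * by left; rewrite -r2.
    * by left; rewrite r1.
    * right; split; first by rewrite r1.
      by case: c1 => [/eqP ->|tx]; [|right].
- move=> x y xy; apply/asboolP; have [z zE zge] := realization_gap real xy.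
  have [z0|z0] := eqVneq z 0; last first.
    by left; have := gap_gt0 zE; apply; lia.
  right; split; first by apply/eqP; rewrite -subr_eq0 zE z0.
  have := (proj1 adm) x y xy; rewrite z0 in zge.
  case/or3P => [/eqP ->|/eqP up|/andP[tx ty]]; first by left.
    by rewrite up eqxx in zge.
  by right; split; [move: tx ty => /eqP tx /eqP ty; lia | right].
Qed.

Hypothesis ncr : noncritical G.

Lemma posnat_neq0 (x : R[i]) : is_posnat x -> x != 0.
Proof. by case=> n ->; rewrite pnatr_eq0. Qed.

Lemma realization_inj L u v : realization G L -> vrow u = vrow v -> ~~ top u ->
  L u = L v -> u = v.
Proof.
move=> real ruv tu Luv.
have /orP[] : connect (arrow G) u v || connect (arrow G) v u.
  by apply: ncr => //; apply: (proj2 real) => //; exists 0; rewrite Luv subrr.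
  move=> /(connect_gap real)[/posnat_neq0|[_]]; first by rewrite Luv subrr eqxx.
  by rewrite ruv ltnn => -[|[_ [/eqP|]]] //; rewrite (negbTE tu).
move=> /(connect_gap real)[/posnat_neq0|[_]]; first by rewrite Luv subrr eqxx.
rewrite ruv ltnn => -[|[_ [/eqP|]]] //; rewrite /top -ruv.
by move: tu; rewrite /top => /negbTE ->.
Qed.

(** Take the first vertex w of an oriented path from [u] to [v]. The total decrease is 1, which
    leaves only L w = L u if the path starts downwards and L w = L v if it starts upwards. *)
Lemma zero_set_neq0 L u v : realization G L -> vrow u = vrow v -> ~~ top u ->
  L u - L v = 1 -> exists w, w \in zero_set L u v.
Proof.
move=> real ruv tu Luv.
have npos (a : nat) : L v - L u = a%:R -> False.
  move=> E; have /eqP : a.+1%:R = 0 :> R[i] by rewrite -natr1 -E -opprB Luv addNr.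
  by rewrite pnatr_eq0.
have /orP[|/(connect_gap real)[[n /npos //]|[Lvu _]]] :
    connect (arrow G) u v || connect (arrow G) v u; last first.
- by case: (npos 0%N); rewrite Lvu subrr.
- move=> /connectP[[|w p] /=]; first by move=> _ E; move/eqP: Luv; rewrite E subrr eq_sym oner_eq0.
  move=> /andP[uw wp] vE; have wv : connect (arrow G) w v by apply/connectP; exists p.
  exists w; have [z zE zge] := realization_gap real uw.
  have := connect_gap real wv.
  have LwE : L w = L u - z%:~R by rewrite -zE subKr.
  have Lwv : L w - L v = (1 - z)%:~R by rewrite LwE addrAC Luv intrB.
  rewrite inE; have := (proj1 adm) u w uw; rewrite (negbTE tu) /= orbF.
  case/orP => [/eqP dn|/eqP up] gap.
    rewrite dn eqxx /= [(_ == _.+1)]ltn_eqF /=; last by lia.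
    have [z0|z0] := eqVneq z 0; first by rewrite LwE z0 subr0.
    case: gap => [[n]|[Lwv0]]; last by lia.
    rewrite Lwv pmulrn => /intr_inj; rewrite dn in zge; lia.
  rewrite up eqxx /= in zge *; rewrite orbC [(_ == _)]gtn_eqF /=; last by lia.
  case: gap => [[n]|[-> _]]; last by rewrite eqxx.
  rewrite Lwv pmulrn => /intr_inj; lia.
- by apply: ncr => //; apply: (proj2 real) => //; exists 1; rewrite Luv.
Qed.

(* The pole of a Serre relation at [L v - L v' = 1] is cancelled by a factor  *)
(* that involves none of the moved entries: pushing the entries other than    *)
(* [v], [v'], [p] on one side of [v] or [v'] by one step against the move     *)
(* gives a realization, to which [double_zeros] applies.                      *)
Lemma serre_zero e L v v' p : double_zeros R G -> realization G L ->
  realization G (foldl (fun M x => shift_entry M x (sg e)) L [:: v; v'; p]) ->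
  vrow v = vrow v' -> ~~ top v -> vrow p != vrow v -> L v - L v' = 1 ->
  exists w, [/\ nb e v w, w != p & L w = L v \/ L w = L v'].
Proof.
move=> dz real realF rv tv rp Lv.
pose l := [:: v; v'; p].
have vv' : v != v'.
  by apply: contraTneq isT => vE; move/eqP: Lv; rewrite vE subrr eq_sym oner_eq0.
have ul : uniq l.
  rewrite /= !inE negb_or vv' andbT /=; apply/andP; split.
    by apply: contraNneq rp => <-.
  by apply: contraNneq rp => <-; rewrite rv.
(* [b] and the inequality in [Q] are chosen so that a zero of [L1] other than [p] cannot lie in the
   row opposite to the numerator row of [v]: its distance to [b] would contradict [Q] or its
   negation. *)
pose b := if e then v else v'.
pose Q w := `[< exists2 z : int, L w - L b = z%:~R & if e then z <= 0 else 0 <= z >].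
pose g w : int := if (w \notin l) && Q w then - eps e else 0.
pose L1 : tableau R m := [ffun w => L w + (g w)%:~R].
have real1 : realization G L1.
  have L1E w : L1 w = L w + (g w)%:~R by rewrite ffunE.
  apply: (realization_shift L1E real) => u u' z uu' zE zge.
  have [y yE] := realization_gap realF uu'.
  have {yE} -> : y = z + eps e *+ (u \in l) - eps e *+ (u' \in l).
    apply: (@intr_inj R[i]); rewrite -yE !shift_entriesE !count_uniq_mem // !sgE intrB intrD -zE.
    by case: (u \in l); case: (u' \in l); rewrite ?mulr1n ?mulr0n; ring.
  rewrite /g; case: (u \in l); case: (u' \in l) => /=; rewrite ?mulr1n ?mulr0n.
  - lia.
  - by case: (Q u') => /=; case: (e); lia.
  - by case: (Q u) => /=; case: (e); lia.
  have Qz : if e then Q u -> Q u' else Q u' -> Q u.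
    rewrite /Q; have z0 : 0 <= z by apply: le_trans zge.
    case: (e) => /asboolP[y' yE y0]; apply/asboolP.
      exists (y' - z); last by lia.
      by rewrite intrB -zE -yE; ring.
    exists (y' + z); last by lia.
    by rewrite intrD -zE -yE; ring.
  move=> _; case: (Q u) Qz; case: (Q u'); case: (e) => //= Qz; try lia;
    by have := Qz isT.
have L1l w : w \in l -> L1 w = L w by move=> wl; rewrite ffunE /g wl addr0.
have L1v : L1 v = L v by rewrite L1l // !inE eqxx.
have L1v' : L1 v' = L v' by rewrite L1l // !inE eqxx orbT.
have := dz L1 v v' real1 rv tv; rewrite L1v L1v' => /(_ Lv).
move=> /card_gt1P[w1 [w2 [w1S w2S w12]]].
(* The moved vertex [p] may be one of the zeros; having two leaves another. *)
have [w wS wp] : exists2 w, w \in zero_set L1 v v' & w != p.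
  by have [w1p|] := eqVneq w1 p; [exists w2; rewrite // -w1p eq_sym | exists w1].
exists w; move: wS; rewrite inE L1v L1v'.
have LvE : L v = L v' + 1 by rewrite -Lv; ring.
have wl : (vrow w == (vrow v).+1) || ((vrow w).+1 == vrow v) -> w \notin l.
  move=> rw; rewrite !inE (negbTE wp) orbF negb_or; apply/andP; split.
    by apply: contraTneq rw => ->; lia.
  by apply: contraTneq rw => ->; rewrite rv; lia.
have L1w : w \notin l -> L1 w = L w - sg e *+ Q w.
  by rewrite ffunE /g sgE => ->; case: (Q w); rewrite ?mulr0n ?mulr1n ?intrN ?subr0 ?addr0.
case: (boolP (vrow w == (vrow v).+1)) wl L1w => rw wl L1w /=.
- have {wl}wl := wl isT; have {}L1w := L1w wl.
  rewrite [_ == vrow v]gtn_eqF ?andFb ?orbF; last by lia.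
  rewrite L1w => /eqP E; rewrite /nb /sg in E *; move: E.
  case: (boolP (Q w)); rewrite /Q /b; case: (e) => /asboolP Qw; rewrite ?mulr1n ?mulr0n ?subr0 => E.
  + by split=> //; left; rewrite LvE -E subrK.
  + case: Qw => z zE z0; have : z = -1; last by lia.
    by apply: (@intr_inj R[i]); rewrite -zE -E intrN; ring.
  + by split=> //; right.
  + by case: Qw; exists 0 => //; rewrite E subrr.
- move=> /andP[rw' /eqP]; rewrite rw' in wl; have {wl}wl := wl isT; rewrite (L1w wl) => E.
  rewrite /nb /sg in E *; move: E; rewrite rw'.
  case: (boolP (Q w)); rewrite /Q /b; case: (e) => /asboolP Qw; rewrite ?mulr1n ?mulr0n ?subr0 => E.
  + case: Qw => z zE z0; have : z = 1; last by lia.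
    by apply: (@intr_inj R[i]); rewrite -zE -E; ring.
  + split=> //; right; apply: (addIr 1); rewrite -LvE -E; ring.
  + by case: Qw; exists 0 => //; rewrite E subrr.
  + by split=> //; left.
Qed.

End Moves.

(** * Products of raising and lowering operators *)

Section Operators.

Variables (R : realType) (m : nat) (G : graph m).
Implicit Types (L : tableau R m) (u v w p : vertex m) (e : bool) (r : nat).

Variables (V : lmodType R[i]) (T : tableau R m -> V) (valid : tableau R m -> Prop).
Variable gt_op : bool -> nat -> lin_end V.

Definition gt_step e r L : V :=
  \sum_(v | vrow v == r) gt_coef e L v *: T (shift_entry L v (sg e)).

Hypothesis T_invalid : forall L, ~ valid L -> T L = 0.
Hypothesis valid_real : forall L, valid L -> realization G L.
Hypothesis valid_shift : forall e L v, valid L -> ~~ top v ->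
  realization G (shift_entry L v (sg e)) -> valid (shift_entry L v (sg e)).
Hypothesis gt_opE : forall e r L, valid L -> gt_op e r (T L) = gt_step e r L.

(** [T] is 0 at a non-realization, while the expression [gt_step] is still written down there; the
    indicator accounts for the difference. *)
Lemma gt_op_step e e' r L v : valid L -> ~~ top v ->
  gt_op e r (T (shift_entry L v (sg e'))) =
  (`[< realization G (shift_entry L v (sg e')) >])%:R
    *: gt_step e r (shift_entry L v (sg e')).
Proof.
move=> vL tv; case: asboolP => rM; last first.
  by rewrite scale0r T_invalid ?lin_end0 // => /valid_real.
by rewrite scale1r gt_opE //; apply: valid_shift.
Qed.

Lemma top_row r v : (r.+1 < m)%N -> vrow v == r -> ~~ top v.
Proof. by move=> rm /eqP rv; rewrite /top rv ltn_eqF. Qed.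

Lemma gt_op2 e e' r r' L : valid L -> (r'.+1 < m)%N ->
  gt_op e r (gt_op e' r' (T L)) =
  \sum_(v | vrow v == r') \sum_(w | vrow w == r)
    (gt_coef e' L v * gt_coef e (shift_entry L v (sg e')) w *
      (`[< realization G (shift_entry L v (sg e')) >])%:R)
    *: T (shift_entry (shift_entry L v (sg e')) w (sg e)).
Proof.
move=> vL rm; rewrite (gt_opE e' r') // lin_end_sum.
apply: eq_bigr => v rv; have tv := top_row rm rv.
rewrite lin_endZ gt_op_step // scalerA scaler_sumr; apply: eq_bigr => w _.
by rewrite scalerA mulrAC.
Qed.

Hypothesis adm : admissible G.

(** No indicator is left: a path that leaves the realizations has coefficient 0 by [gt_coef_detour3]
    if it ends at a valid tableau, and [T] kills its end otherwise. *)
Lemma gt_op3 e r1 r2 r3 L : valid L -> (r1.+1 < m)%N -> (r2.+1 < m)%N ->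
  gt_op e r3 (gt_op e r2 (gt_op e r1 (T L))) =
  \sum_(u | vrow u == r1) \sum_(v | vrow v == r2) \sum_(w | vrow w == r3)
    (gt_coef e L u * gt_coef e (shift_entry L u (sg e)) v *
     gt_coef e (shift_entry (shift_entry L u (sg e)) v (sg e)) w)
    *: T (foldl (fun M x => shift_entry M x (sg e)) L [:: u; v; w]).
Proof.
move=> vL rm1 rm2; rewrite gt_op2 // lin_end_sum; apply: eq_bigr => u ru.
have tu := top_row rm1 ru; rewrite lin_end_sum; apply: eq_bigr => v rv.
have tv := top_row rm2 rv; rewrite lin_endZ.
set M1 := shift_entry L u _; set M2 := shift_entry M1 v _.
have E : gt_op e r3 (T M2) *+ `[< realization G M1 >] =
    (`[< realization G M1 >] && `[< realization G M2 >])%:R *: gt_step e r3 M2.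
  case: asboolP => [rM1|_]; last by rewrite scale0r mulr0n.
  by rewrite mulr1n gt_op_step //; apply: valid_shift.
rewrite -scalerA -[X in _ *: X]/((_ : nat)%:R *: gt_op e r3 (T M2)).
rewrite scaler_nat E scalerA scaler_sumr; apply: eq_bigr => w _.
rewrite scalerA mulrAC /= -/M1 -/M2.
have [vF|nvF] := pselect (valid (shift_entry M2 w (sg e))); last first.
  by rewrite T_invalid // !scaler0.
case: asboolP => rM1; case: asboolP => rM2; rewrite /= ?mulr1 //; rewrite mulr0 scale0r.
all: rewrite (gt_coef_detour3 adm tu tv (valid_real vL) (valid_real vF)) ?scale0r //; by case.
Qed.

End Operators.

(** * Commutation of coefficients *)

Section Coefficients.

Variables (R : realType) (m : nat).
Implicit Types (L : tableau R m) (u v w p : vertex m) (e : bool).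

(** The part of the coefficient of [v] that moves of other vertices in [S] leave unchanged;
    identities then concern only the few factors indexed by [S]. *)
Definition gt_rest e L v (S : pred (vertex m)) : R[i] :=
  (\prod_(w | nb e v w && ~~ S w) (L v - L w)) /
  (\prod_(w | ((vrow w == vrow v) && (w != v)) && ~~ S w) (L v - L w)).

Lemma gt_coef_split e L v (S : pred (vertex m)) : gt_coef e L v =
  gt_rest e L v S *
  ((\prod_(w | nb e v w && S w) (L v - L w)) /
   (\prod_(w | ((vrow w == vrow v) && (w != v)) && S w) (L v - L w))).
Proof.
rewrite /gt_coef (bigID S) /= [X in _ / X](bigID S) /= /gt_rest.
by rewrite mulf_div; congr (_ / _); rewrite mulrC.
Qed.

Lemma gt_rest_eq e L L' v S : L' v = L v -> (forall w, ~~ S w -> L' w = L w) ->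
  gt_rest e L' v S = gt_rest e L v S.
Proof.
move=> Lv LS; rewrite /gt_rest; congr (_ / _); apply: eq_bigr => w /andP[_ /LS ->];
  by rewrite Lv.
Qed.

Lemma gt_rest_eq0 e L v w (S : pred (vertex m)) : nb e v w -> ~~ S w -> L w = L v ->
  gt_rest e L v S = 0.
Proof.
by move=> vw Sw Lw; rewrite /gt_rest (bigD1 w) ?vw //= Lw subrr !mul0r.
Qed.

Lemma prod_pred1_and (P : pred (vertex m)) w (F : vertex m -> R[i]) :
  \prod_(x | P x && pred1 w x) F x = if P w then F w else 1.
Proof.
case: ifP => Pw; last first.
  by rewrite big_pred0 // => x; rewrite /=; case: eqP => [->|_]; rewrite ?Pw ?andbF.
rewrite (bigD1 w) /= ?Pw ?eqxx // big1 ?mulr1 // => x /andP[/andP[_ /eqP ->]].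
by rewrite eqxx.
Qed.

Lemma gt_coef_split1 e L v w : v != w -> gt_coef e L w =
  gt_rest e L w (pred1 v) *
  ((if nb e w v then L w - L v else 1) / (if vrow v == vrow w then L w - L v else 1)).
Proof.
by move=> vw; rewrite (gt_coef_split e L w (pred1 v)) !prod_pred1_and vw andbT.
Qed.

(** Only the factors comparing [v] with [w] depend on the order. For opposite directions their signs
    cancel in pairs; in the other case there are no such factors. *)
Lemma gt_coef_comm e e' L v w : v != w ->
  e' = ~~ e \/ [&& vrow v != vrow w, ~~ nb e w v & ~~ nb e' v w] ->
  gt_coef e' L v * gt_coef e (shift_entry L v (sg e')) w =
  gt_coef e L w * gt_coef e' (shift_entry L w (sg e)) v.
Proof.
move=> vw C; have wv : w != v by rewrite eq_sym.
rewrite !(gt_coef_split1 _ _ vw) !(gt_coef_split1 _ _ wv).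
have restE b x y c : x != y ->
    gt_rest b (shift_entry L x c) y (pred1 x) = gt_rest b L y (pred1 x).
  move=> xy; apply: gt_rest_eq => [|z /=]; rewrite shift_entryE.
    by rewrite eq_sym (negbTE xy) addr0.
  by move=> /negbTE ->; rewrite addr0.
rewrite !restE //.
rewrite !shift_entryE !eqxx (negbTE vw) (negbTE wv) !mulr1n !mulr0n !addr0.
rewrite [vrow w == vrow v]eq_sym.
case: C => [->|/and3P[/negbTE -> /negbTE -> /negbTE ->]]; last first.
  by rewrite !divr1 !mulr1 mulrC.
rewrite nbN sgN; set a := gt_rest _ _ _ _; set b := gt_rest _ _ _ _.
have -> : L w - (L v - sg e) = - (L v - (L w + sg e)) by ring.
have -> : L w - L v = - (L v - L w) by ring.
by case: (nb e w v); case: (vrow v == vrow w); rewrite ?invrN; ring.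
Qed.

End Coefficients.

(** * Serre relations for coefficients *)

Section SerreIdentities.

Variables (F : fieldType) (x x' y s : F).
Hypotheses (nz0 : x - x' != 0) (nzp : x - x' + s != 0) (nzm : x - x' - s != 0).

(** [x], [x'], [y] are the entries at v, v', p and [s] is the step; each half lists the orders v v'
    p, v p v', p v v'. Here p enters the numerators of v and v'; in [serre_identityB], v and v'
    enter that of p. *)
Lemma serre_identityA :
  (x - y) / (x - x') * ((x' - y) / (x' - (x + s)))
  - 2%:R * ((x - y) / (x - x') * ((x' - (y + s)) / (x' - (x + s))))
  + (x - (y + s)) / (x - x') * ((x' - (y + s)) / (x' - (x + s)))
  + ((x' - y) / (x' - x) * ((x - y) / (x - (x' + s)))
  - 2%:R * ((x' - y) / (x' - x) * ((x - (y + s)) / (x - (x' + s))))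
  + (x' - (y + s)) / (x' - x) * ((x - (y + s)) / (x - (x' + s)))) = 0.
Proof.
have nz0' : x' - x != 0 by rewrite -opprB oppr_eq0.
have nz1 : x' - (x + s) != 0 by rewrite -oppr_eq0 opprB addrAC.
have nz2 : x - (x' + s) != 0 by rewrite opprD addrA.
by field; rewrite nz0 nz0' nz1 nz2.
Qed.

Lemma serre_identityB :
  (x - x')^-1 * (x' - (x + s))^-1 * ((y - (x + s)) * (y - (x' + s)))
  - 2%:R * ((x - x')^-1 * (x' - (x + s))^-1 * ((y - (x + s)) * (y - x')))
  + (x - x')^-1 * (x' - (x + s))^-1 * ((y - x) * (y - x'))
  + ((x' - x)^-1 * (x - (x' + s))^-1 * ((y - (x + s)) * (y - (x' + s)))
  - 2%:R * ((x' - x)^-1 * (x - (x' + s))^-1 * ((y - x) * (y - (x' + s))))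
  + (x' - x)^-1 * (x - (x' + s))^-1 * ((y - x) * (y - x'))) = 0.
Proof.
have nz0' : x' - x != 0 by rewrite -opprB oppr_eq0.
have nz1 : x' - (x + s) != 0 by rewrite -oppr_eq0 opprB addrAC.
have nz2 : x - (x' + s) != 0 by rewrite opprD addrA.
by field; rewrite nz0 nz0' nz1 nz2.
Qed.

End SerreIdentities.

Section SerreCoefficients.

Variables (R : realType) (m : nat) (G : graph m).
Implicit Types (L : tableau R m) (u v w p : vertex m) (e : bool).

Hypotheses (adm : admissible G) (ncr : noncritical G) (dz : double_zeros R G).

Lemma gt_rest_shift e L v w c (S : pred (vertex m)) : S w -> v != w ->
  gt_rest e (shift_entry L w c) v S = gt_rest e L v S.
Proof.
move=> Sw vw; apply: gt_rest_eq => [|z Sz]; rewrite shift_entryE.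
  by rewrite (negbTE vw) addr0.
by have [zw|_] := eqVneq z w; [rewrite zw Sw in Sz | rewrite addr0].
Qed.

Lemma nb_same_row e v v' : vrow v = vrow v' -> nb e v v' = false.
Proof. by rewrite /nb => ->; case: e; lia. Qed.

Lemma nb_asym e v p : nb e v p -> nb e p v = false.
Proof. by rewrite /nb; case: e; lia. Qed.

Lemma gt_coef_split2 e L v v' p : v != v' -> vrow v = vrow v' -> vrow p != vrow v ->
  gt_coef e L v = gt_rest e L v (pred2 v' p) *
    ((if nb e v p then L v - L p else 1) / (L v - L v')).
Proof.
move=> vv' rv rp; rewrite (gt_coef_split e L v (pred2 v' p)); congr (_ * (_ / _)).
  rewrite -(prod_pred1_and (nb e v) p (fun x => L v - L x)); apply: eq_bigl => x /=.
  by case: eqP => // ->; rewrite nb_same_row.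
under eq_bigl => x.
  have -> : (vrow x == vrow v) && (x != v) && (pred2 v' p) x =
      (vrow x == vrow v) && (x != v) && pred1 v' x.
    rewrite /=; have [->|_] := eqVneq x p; last by rewrite orbF.
    by rewrite (negbTE rp).
  over.
by rewrite (prod_pred1_and (fun x => (vrow x == vrow v) && (x != v))) rv eqxx eq_sym vv'.
Qed.

Lemma gt_coef_split2p e L v v' p : v != v' -> vrow v = vrow v' -> vrow p != vrow v ->
  gt_coef e L p = gt_rest e L p (pred2 v v') *
    (if nb e p v then (L p - L v) * (L p - L v') else 1).
Proof.
move=> vv' rv rp; rewrite (gt_coef_split e L p (pred2 v v')); congr (_ * _).
rewrite [X in _ / X]big_pred0 ?divr1 => [|x]; last first.
  rewrite /=; have [->|_] /= := eqVneq x v; first by rewrite eq_sym (negbTE rp).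
  have [->|_] := eqVneq x v'; last by rewrite andbF.
  by rewrite -rv eq_sym (negbTE rp).
have nbv' : nb e p v' = nb e p v by rewrite /nb rv.
case: ifP => pv; last first.
  rewrite big_pred0 // => x /=; have [->|_] /= := eqVneq x v; first by rewrite pv.
  by have [->|_] := eqVneq x v'; rewrite ?andbF // nbv' pv.
rewrite (bigD1 v) /= ?pv ?eqxx //; congr (_ * _).
rewrite (bigD1 v') /= ?nbv' ?pv ?eqxx ?orbT // 1?eq_sym // big1 ?mulr1 // => x.
by case: (x == v); case: (x == v'); rewrite ?andbF.
Qed.

Definition path_coef e L u v w : R[i] :=
  gt_coef e L u * gt_coef e (shift_entry L u (sg e)) v *
  gt_coef e (shift_entry (shift_entry L u (sg e)) v (sg e)) w.

(** When [v] moves twice, the sum is a multiple of the second difference of a linear function. *)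
Lemma serre_coef_eq e L v p : nb e v p || nb e p v ->
  path_coef e L v v p - 2%:R * path_coef e L v p v + path_coef e L p v v = 0.
Proof.
move=> adj.
have rpv : (vrow p == vrow v) = false.
  by case/orP: adj => /nb_row_neq; rewrite // eq_sym.
have pv : p != v by apply: contraFneq rpv => ->.
have vp : v != p by rewrite eq_sym.
rewrite /path_coef [shift_entry (shift_entry L p _) v _]shift_entryC.
rewrite !(gt_coef_split1 e _ pv) !(gt_coef_split1 e _ vp).
rewrite [vrow v == vrow p]eq_sym !rpv !divr1.
rewrite !(gt_rest_shift _ _ _ (w := p) (v := v)) ?(gt_rest_shift _ _ _ (w := v) (v := p)) //=.
rewrite !shift_entryE !eqxx (negbTE pv) (negbTE vp) !mulr1n !mulr0n !addr0.
have [vp1|nvp] := boolP (nb e v p); have [pv1|npv] := boolP (nb e p v).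
- by rewrite (nb_asym vp1) in pv1.
- ring.
- ring.
- by rewrite (negbTE nvp) (negbTE npv) in adj.
Qed.

(** The rational identity fails to apply only if L v - L v' is 0, 1 or -1. The value 0 is excluded
    by [realization_inj]; at 1 and -1 the common factor [rv0 * rv0'] vanishes by [serre_zero]. *)
Lemma serre_coef e L v v' p : realization G L ->
  realization G (foldl (fun M x => shift_entry M x (sg e)) L [:: v; v'; p]) ->
  vrow v = vrow v' -> ~~ top v -> nb e v p || nb e p v ->
  path_coef e L v v' p - 2%:R * path_coef e L v p v' + path_coef e L p v v' +
  (path_coef e L v' v p - 2%:R * path_coef e L v' p v + path_coef e L p v' v) = 0.
Proof.
move=> real realF rv tv adj; have [<-|vv'] := eqVneq v v'.
  by rewrite serre_coef_eq // addr0.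
have v'v : v' != v by rewrite eq_sym.
have rpv : vrow p != vrow v.
  by case/orP: adj => /nb_row_neq; [move=> -> | rewrite eq_sym => ->].
have rpv' : vrow p != vrow v' by rewrite -rv.
have pv : p != v by apply: contraNneq rpv => ->.
have vp : v != p by rewrite eq_sym.
have pv' : p != v' by apply: contraNneq rpv' => ->.
have v'p : v' != p by rewrite eq_sym.
have tv' : ~~ top v' by move: tv; rewrite /top rv.
have nbv' : nb e v' p = nb e v p by rewrite /nb rv.
pose rv0 := gt_rest e L v (pred2 v' p); pose rv0' := gt_rest e L v' (pred2 v p).
pose rp0 := gt_rest e L p (pred2 v v').
have zero : L v - L v' = 1 \/ L v - L v' = -1 -> rv0 * rv0' = 0.
  have nbw w : nb e v w -> ~~ (pred2 v' p) w = (w != p) /\ ~~ (pred2 v p) w = (w != p).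
    move=> vw; have rw := nb_row_neq vw; rewrite /=; split.
      by have [wv|] := eqVneq w v'; [rewrite wv rv eqxx in rw | rewrite orFb].
    by have [wv|] := eqVneq w v; [rewrite wv eqxx in rw | rewrite orFb].
  have nbE w : nb e v' w = nb e v w by rewrite /nb rv.
  case=> Lv.
    have [w [vw wp Lw]] := serre_zero dz real realF rv tv rpv Lv.
    have [n1 n2] := nbw w vw.
    case: Lw => Lw; first by rewrite /rv0 (gt_rest_eq0 vw) ?mul0r ?n1.
    by rewrite /rv0' (gt_rest_eq0 (w := w)) ?mulr0 ?n2 ?nbE.
  have realF' : realization G (foldl (fun M x => shift_entry M x (sg e)) L [:: v'; v; p]).
    by rewrite /= [shift_entry (shift_entry L v' _) _ _]shift_entryC.
  have Lv' : L v' - L v = 1 by rewrite -opprB Lv opprK.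
  have [w [vw wp Lw]] := serre_zero dz real realF' (esym rv) tv' rpv' Lv'.
  rewrite nbE in vw; have [n1 n2] := nbw w vw.
  case: Lw => Lw; last by rewrite /rv0 (gt_rest_eq0 vw) ?mul0r ?n1.
  by rewrite /rv0' (gt_rest_eq0 (w := w)) ?mulr0 ?n2 ?nbE.
rewrite /path_coef.
rewrite !(gt_coef_split2 e _ vv' rv rpv) !(gt_coef_split2 e _ v'v (esym rv) rpv').
rewrite !(gt_coef_split2p e _ vv' rv rpv) nbv'.
have restE (x y z : vertex m) : x != y -> x != z ->
    (forall M : tableau R m, gt_rest e (shift_entry M y (sg e)) x (pred2 y z) = gt_rest e M x (pred2 y z)) *
    (forall M : tableau R m, gt_rest e (shift_entry M z (sg e)) x (pred2 y z) = gt_rest e M x (pred2 y z)).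
  by move=> xy xz; split=> M; rewrite gt_rest_shift //= eqxx ?orbT.
rewrite !(restE v v' p vv' vp, restE v' v p v'v v'p, restE p v v' pv pv').
rewrite -/rv0 -/rv0' -/rp0.
rewrite !shift_entryE !eqxx (negbTE pv) (negbTE vp) (negbTE pv') (negbTE v'p).
rewrite (negbTE vv') (negbTE v'v) !mulr1n !mulr0n !addr0.
have [pole|npole] := pselect (L v - L v' = 1 \/ L v - L v' = -1).
  have /eqP := zero pole; rewrite mulf_eq0 => /orP[] /eqP ->;
    by rewrite !(mul0r, mulr0, subr0, addr0).
have nz0 : L v - L v' != 0.
  by apply: contraNneq vv' => /subr0_eq/(realization_inj adm ncr real rv tv) ->.
have nzp : L v - L v' + sg e != 0.
  apply: contra_notN npole; rewrite addr_eq0 => /eqP ->.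
  by case: (e); rewrite /sg ?opprK; [right | left].
have nzm : L v - L v' - sg e != 0.
  apply: contra_notN npole; rewrite subr_eq0 => /eqP ->.
  by case: (e); rewrite /sg ?opprK; [left | right].
have [vp1|nvp] := boolP (nb e v p); have [pv1|npv] := boolP (nb e p v).
- by rewrite (nb_asym vp1) in pv1.
- have I := serre_identityA (L p) nz0 nzp nzm.
  rewrite -[RHS](mulr0 (rv0 * rv0' * rp0)) -I; ring.
- have I := serre_identityB (L p) nz0 nzp nzm.
  rewrite -[RHS](mulr0 (rv0 * rv0' * rp0)) -I; ring.
- by rewrite (negbTE nvp) (negbTE npv) in adj.
Qed.

End SerreCoefficients.

(** * Commutation and Serre relations for the operators *)

Section OperatorRelations.

Variables (R : realType) (m : nat) (G : graph m).
Implicit Types (L : tableau R m) (u v w p : vertex m) (e : bool) (r : nat).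

Variables (V : lmodType R[i]) (T : tableau R m -> V) (valid : tableau R m -> Prop).
Variable gt_op : bool -> nat -> lin_end V.

Hypothesis T_invalid : forall L, ~ valid L -> T L = 0.
Hypothesis valid_real : forall L, valid L -> realization G L.
Hypothesis valid_shift : forall e L v, valid L -> ~~ top v ->
  realization G (shift_entry L v (sg e)) -> valid (shift_entry L v (sg e)).
Hypothesis gt_opE : forall e r L, valid L -> gt_op e r (T L) = gt_step T e r L.
Hypothesis adm : admissible G.

Let op2 := gt_op2 T_invalid valid_real valid_shift gt_opE.
Let op3 := gt_op3 T_invalid valid_real valid_shift gt_opE adm.

Definition gt_term e e' L v w : V :=
  (gt_coef e' L v * gt_coef e (shift_entry L v (sg e')) w *
    (`[< realization G (shift_entry L v (sg e')) >])%:R)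
  *: T (shift_entry (shift_entry L v (sg e')) w (sg e)).

Definition far v w : bool :=
  [&& vrow v != vrow w, vrow w != (vrow v).+1 & vrow v != (vrow w).+1].

Lemma far_arrow v w : far v w -> ~~ top v -> ~~ arrow G v w && ~~ arrow G w v.
Proof.
move=> /and3P[r1 r2 r3] tv; apply/andP; split; apply/negP => /(proj1 adm);
  by rewrite (negbTE r2) (negbTE r3) (negbTE tv) ?andbF.
Qed.

Lemma gt_term_comm e e' L v w : valid L -> v != w -> ~~ top v -> ~~ top w ->
  e' = ~~ e \/ far v w -> gt_term e e' L v w = gt_term e' e L w v.
Proof.
move=> vL vw tv tw C; rewrite /gt_term [in RHS]shift_entryC.
have [vF|nvF] := pselect (valid (shift_entry (shift_entry L v (sg e')) w (sg e)));
  last by rewrite T_invalid // !scaler0.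
have realF := valid_real vF; have real := valid_real vL.
have C1 : e = ~~ e' \/ ~~ arrow G v w && ~~ arrow G w v.
  by case: C => [->|fvw]; [left; rewrite negbK | right; apply: far_arrow].
have C2 : e' = ~~ e \/ ~~ arrow G w v && ~~ arrow G v w.
  by case: C1 => [->|]; [left; rewrite negbK | right; rewrite andbC].
rewrite (asboolT (realization_between vw real realF C1)).
rewrite shift_entryC in realF; have wv : w != v by rewrite eq_sym.
rewrite (asboolT (realization_between wv real realF C2)) !mulr1.
rewrite gt_coef_comm //; case: C => [->|/and3P[r1 r2 r3]]; [by left | right].
rewrite r1 /= /nb [(vrow w).+1 == _]eq_sym [(vrow v).+1 == _]eq_sym.
by case: (e); case: (e'); rewrite ?r2 ?r3.
Qed.

Lemma gt_op_comm e e' r r' L : valid L -> (r.+1 < m)%N -> (r'.+1 < m)%N -> r != r' ->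
  e' = ~~ e \/ (r.+1 != r') && (r'.+1 != r) ->
  gt_op e r (gt_op e' r' (T L)) = gt_op e' r' (gt_op e r (T L)).
Proof.
move=> vL rm rm' rr' C; rewrite !op2 // exchange_big /=.
apply: eq_bigr => w rw; apply: eq_bigr => v rv; apply: gt_term_comm => //.
- by apply: contraNneq rr' => vw; rewrite -(eqP rw) -(eqP rv) vw.
- exact: top_row rv.
- exact: top_row rw.
- case: C => [|/andP[r1 r2]]; [by left | right].
  by rewrite /far (eqP rv) (eqP rw) [r' == _]eq_sym rr' [r == r'.+1]eq_sym r2 eq_sym r1.
Qed.

Lemma gt_coef_detour2 e L v : realization G L -> ~~ top v ->
  ~ realization G (shift_entry L v (sg e)) ->
  gt_coef e L v * gt_coef (~~ e) (shift_entry L v (sg e)) v = 0.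
Proof.
move=> real tv nreal; have [[w vw Lw]|[w wb Lw]] := realization_exit adm real tv nreal.
  by rewrite (gt_coef_eq0 vw) ?mul0r.
have wv := nb_neq (proj1 wb).
rewrite [X in _ * X](gt_coef_eq0 (w := w)) ?mulr0 ?nbN //; first by case: wb.
by rewrite !shift_entryE eqxx [w == v]eq_sym (negbTE wv) addr0 Lw.
Qed.

(** Opposite moves of two different entries commute, so only the paths returning to [L] survive. *)
Lemma gt_op_cartan e r L : valid L -> (r.+1 < m)%N ->
  gt_op e r (gt_op (~~ e) r (T L)) - gt_op (~~ e) r (gt_op e r (T L)) =
  (\sum_(v | vrow v == r)
    (gt_coef (~~ e) L v * gt_coef e (shift_entry L v (sg (~~ e))) v -
     gt_coef e L v * gt_coef (~~ e) (shift_entry L v (sg e)) v)) *: T L.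
Proof.
move=> vL rm; rewrite !op2 //.
have split_diag e1 e2 : \sum_(v | vrow v == r) \sum_(w | vrow w == r) gt_term e1 e2 L v w =
    \sum_(v | vrow v == r) gt_term e1 e2 L v v +
    \sum_(v | vrow v == r) \sum_(w | (vrow w == r) && (w != v)) gt_term e1 e2 L v w.
  by rewrite -big_split; apply: eq_bigr => v rv; rewrite (bigD1 v).
rewrite [X in X - _]split_diag [X in _ - X]split_diag.
have -> : \sum_(v | vrow v == r) \sum_(w | (vrow w == r) && (w != v)) gt_term e (~~ e) L v w =
    \sum_(v | vrow v == r) \sum_(w | (vrow w == r) && (w != v)) gt_term (~~ e) e L v w.
  rewrite (exchange_big_dep (fun w => vrow w == r)) /=; last by move=> v w _ /andP[].
  apply: eq_bigr => w rw; apply: eq_big => [v|v /and3P[rv _ wv]].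
    by rewrite rw [w == v]eq_sym.
  by apply: gt_term_comm; rewrite ?(eq_sym v) //; [exact: top_row rv | exact: top_row rw | left].
rewrite opprD addrACA subrr addr0 -sumrB scaler_suml; apply: eq_bigr => v rv.
have tv := top_row rm rv.
have diag e1 e2 : e1 = ~~ e2 -> gt_term e1 e2 L v v =
    (gt_coef e2 L v * gt_coef e1 (shift_entry L v (sg e2)) v) *: T L.
  move=> ->; rewrite /gt_term sgN shift_entryK; congr (_ *: _).
  case: asboolP => [_|nreal]; first by rewrite mulr1.
  by rewrite mulr0 gt_coef_detour2 //; apply: valid_real.
by rewrite !diag ?negbK // -scalerBl.
Qed.

Lemma gt_op_serre e ra rb L : noncritical G -> double_zeros R G -> valid L ->
  (ra.+1 < m)%N -> (rb.+1 < m)%N -> (rb == ra.+1) || (ra == rb.+1) ->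
  gt_op e ra (gt_op e ra (gt_op e rb (T L)))
  - 2%:R *: gt_op e ra (gt_op e rb (gt_op e ra (T L)))
  + gt_op e rb (gt_op e ra (gt_op e ra (T L))) = 0.
Proof.
move=> ncr dz vL ram rbm adj.
pose F v v' p := T (foldl (fun M x => shift_entry M x (sg e)) L [:: v; v'; p]).
have FC v v' p : F v v' p = F v' v p by rewrite /F /= (shift_entryC L v v').
pose K v v' p := path_coef e L v v' p - 2%:R * path_coef e L v p v' + path_coef e L p v v'.
have E1 : gt_op e ra (gt_op e ra (gt_op e rb (T L))) =
    \sum_(v | vrow v == ra) \sum_(v' | vrow v' == ra) \sum_(p | vrow p == rb)
      path_coef e L p v v' *: F v v' p.
  rewrite op3 // exchange_big /=; apply: eq_bigr => v _.
  rewrite exchange_big /=; apply: eq_bigr => v' _; apply: eq_bigr => p _.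
  by congr (_ *: _); rewrite /F /= (shift_entryC L p) (shift_entryC (shift_entry L v _) p).
have E2 : gt_op e ra (gt_op e rb (gt_op e ra (T L))) =
    \sum_(v | vrow v == ra) \sum_(v' | vrow v' == ra) \sum_(p | vrow p == rb)
      path_coef e L v p v' *: F v v' p.
  rewrite op3 //; apply: eq_bigr => v _.
  rewrite exchange_big /=; apply: eq_bigr => v' _; apply: eq_bigr => p _.
  by congr (_ *: _); rewrite /F /= (shift_entryC (shift_entry L v _) p).
have E3 : gt_op e rb (gt_op e ra (gt_op e ra (T L))) =
    \sum_(v | vrow v == ra) \sum_(v' | vrow v' == ra) \sum_(p | vrow p == rb)
      path_coef e L v v' p *: F v v' p.
  by rewrite op3.
pose S := \sum_(v | vrow v == ra) \sum_(v' | vrow v' == ra) \sum_(p | vrow p == rb)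
      K v v' p *: F v v' p.
have -> : gt_op e ra (gt_op e ra (gt_op e rb (T L)))
  - 2%:R *: gt_op e ra (gt_op e rb (gt_op e ra (T L)))
  + gt_op e rb (gt_op e ra (gt_op e ra (T L))) = S.
  rewrite E1 E2 E3 scaler_sumr -sumrB -big_split; apply: eq_bigr => v _ /=.
  rewrite scaler_sumr -sumrB -big_split; apply: eq_bigr => v' _ /=.
  rewrite scaler_sumr -sumrB -big_split; apply: eq_bigr => p _ /=.
  by rewrite scalerA -scalerBl -scalerDl; congr (_ *: _); rewrite /K; ring.
(* The coefficients cancel only after adding the orders v, v' and v', v, hence the doubled sum. *)
have SS : S + S = 0.
  rewrite {2}/S exchange_big /= -big_split big1 // => v rv /=.
  rewrite -big_split big1 // => v' rv' /=; rewrite -big_split big1 // => p rp /=.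
  rewrite (FC v' v) -scalerDl.
  have [vF|nvF] := pselect (valid (foldl (fun M x => shift_entry M x (sg e)) L [:: v; v'; p]));
    last by rewrite /F T_invalid // scaler0.
  rewrite (serre_coef adm ncr dz (valid_real vL) (valid_real vF)) ?scale0r //.
  - by rewrite (eqP rv) (eqP rv').
  - exact: top_row rv.
  - rewrite /nb (eqP rv) (eqP rp) ![(_).+1 == _]eq_sym.
    by case: (e); rewrite // orbC.
apply/eqP; move/eqP: SS; rewrite -mulr2n -scaler_nat scaler_eq0 pnatr_eq0 /=.
by [].
Qed.

End OperatorRelations.

(** * Diagonal coefficients as sums of residues *)

Lemma card_row (m r : nat) : (r < m)%N -> #|[pred v : vertex m | vrow v == r]| = r.+1.
Proof.
move=> rm; rewrite -(card_in_image (f := @vcol m)); last first.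
  by move=> u v /eqP ru /eqP rv; apply: vertex_eq; rewrite ru.
have -> : #|image (@vcol m) [pred v | vrow v == r]| = #|[pred c : 'I_m | (c < r.+1)%N]|.
  apply: eq_card => c; apply/imageP/idP => [[v /eqP rv ->]|].
    by rewrite inE /= ltnS -rv vcol_le.
  rewrite inE /= ltnS => cr; have [v rv cv] := vertex_ex cr rm.
  by exists v; [rewrite inE /= rv | apply: val_inj; rewrite /= cv].
by rewrite -sum1_card -(big_ord_widen _ (fun _ => 1%N)) // sum1_card card_ord.
Qed.

Section SeqEnum.

Variables (T : finType) (F : fieldType).

Lemma prod_rem_enum (P : pred T) v (f : T -> F) :
  \prod_(w <- rem v (enum P)) f w = \prod_(w | P w && (w != v)) f w.
Proof.
rewrite rem_filter ?enum_uniq // big_filter big_enum_cond /=.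
by apply: eq_bigl => w; rewrite andbC.
Qed.

Lemma count_map_enum (P : pred T) (f : T -> F) t :
  count_mem t [seq f w | w <- enum P] = #|[set w | P w & f w == t]|.
Proof.
rewrite count_map -sum1_count big_enum_cond sum1_card.
by apply: eq_card => w; rewrite !inE.
Qed.

Lemma perm_rem_map (f : T -> F) (s : seq T) v (s' : seq F) : v \in s ->
  perm_eq (rem (f v) (map f s ++ s')) (map f (rem v s) ++ s').
Proof.
move=> vs; have p : perm_eq (map f s ++ s') (f v :: (map f (rem v s) ++ s')).
  by rewrite -cat_cons perm_cat2r -map_cons perm_map // perm_to_rem.
by apply: perm_trans (perm_rem _ p) _; rewrite /= eqxx.
Qed.

End SeqEnum.

Section RowResidues.

Variables (R : realType) (m : nat).
Implicit Types (L : tableau R m) (u v w : vertex m).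

(** At the poles [L v] and [L v + 1], the residues are, up to sign, the coefficients of lowering
    then raising [v] and of raising then lowering it. *)
Definition row_poles L r : seq R[i] :=
  [seq L v | v <- enum [pred v : vertex m | vrow v == r]] ++
  [seq L v + 1 | v <- enum [pred v : vertex m | vrow v == r]].

Definition row_zeros L r : seq R[i] :=
  [seq L v + 1 | v <- enum [pred v : vertex m | vrow v == r.+1]] ++
  [seq L v | v <- enum [pred v : vertex m | (vrow v).+1 == r]].

Lemma size_row_zeros L r : (r.+1 < m)%N -> size (row_zeros L r) = size (row_poles L r).
Proof.
move=> rm; rewrite !size_cat !size_map -!cardE card_row // card_row 1?ltnW //.
case: r rm => [|r] rm; last by rewrite card_row ?addnS // 2?ltnW.
by rewrite eq_card0.
Qed.

Lemma residue_row L r v : vrow v = r ->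
  residue (row_poles L r) (row_zeros L r) (L v) =
  - (gt_coef false L v * gt_coef true (shift_entry L v (sg false)) v).
Proof.
move=> rv; have vr : v \in enum [pred v : vertex m | vrow v == r] by rewrite mem_enum inE rv.
rewrite /residue (perm_big _ (perm_rem_map _ _ vr)) !big_cat !big_map !big_enum /=.
rewrite (prod_rem_enum _ _ (fun w => L v - L w)) /= /gt_coef /nb rv.
set M := shift_entry L v (sg false).
have Mw w : w != v -> M v - M w = L v - (L w + 1).
  by move=> wv; rewrite !shift_entryE eqxx (negbTE wv) mulr1n addr0 /sg; ring.
have -> : \prod_(w : vertex m | vrow w == r.+1) (M v - M w) =
    \prod_(w : vertex m | vrow w == r.+1) (L v - (L w + 1)).
  apply: eq_bigr => w /eqP rw; apply: Mw; apply/eqP => wv.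
  by move: rw; rewrite wv rv; lia.
have -> : \prod_(w | (vrow w == r) && (w != v)) (M v - M w) =
    \prod_(w | (vrow w == r) && (w != v)) (L v - (L w + 1)).
  by apply: eq_bigr => w /andP[_ wv]; apply: Mw.
rewrite [X in _ / (_ * X)](bigD1 v) /= ?inE ?rv //.
have -> : L v - (L v + 1) = -1 by ring.
rewrite mulN1r mulrN invrN mulrN; congr (- _).
by rewrite mulf_div; congr (_ / _); rewrite mulrC.
Qed.

Lemma residue_row1 L r v : vrow v = r ->
  residue (row_poles L r) (row_zeros L r) (L v + 1) =
  gt_coef true L v * gt_coef false (shift_entry L v (sg true)) v.
Proof.
move=> rv; have vr : v \in enum [pred v : vertex m | vrow v == r] by rewrite mem_enum inE rv.
have pC : perm_eq (row_poles L r)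
    ([seq L v + 1 | v <- enum [pred v : vertex m | vrow v == r]] ++
     [seq L v | v <- enum [pred v : vertex m | vrow v == r]]) by rewrite perm_catC.
rewrite (residue_perm _ pC (perm_refl _)) /residue.
rewrite (perm_big _ (perm_rem_map (fun w => L w + 1) _ vr)) !big_cat !big_map !big_enum /=.
rewrite (prod_rem_enum _ _ (fun w => L v + 1 - (L w + 1))) /= /gt_coef /nb rv.
set M := shift_entry L v (sg true).
have Mw w : w != v -> M v - M w = L v + 1 - L w.
  by move=> wv; rewrite !shift_entryE eqxx (negbTE wv) mulr1n addr0 /sg; ring.
have -> : \prod_(w : vertex m | (vrow w).+1 == r) (M v - M w) =
    \prod_(w : vertex m | (vrow w).+1 == r) (L v + 1 - L w).
  apply: eq_bigr => w /eqP rw; apply: Mw; apply/eqP => wv.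
  by move: rw; rewrite wv rv; lia.
have -> : \prod_(w | (vrow w == r) && (w != v)) (M v - M w) =
    \prod_(w | (vrow w == r) && (w != v)) (L v + 1 - L w).
  by apply: eq_bigr => w /andP[_ wv]; apply: Mw.
rewrite [X in _ / (_ * X)](bigD1 v) /= ?inE ?rv //.
have -> : L v + 1 - L v = 1 by ring.
rewrite mul1r mulf_div; congr (_ * _ / (_ * _)); apply: eq_bigr => w _; ring.
Qed.

Lemma residue_sum_row L r : residue_sum (row_poles L r) (row_zeros L r) =
  \sum_(v | vrow v == r)
    (gt_coef true L v * gt_coef false (shift_entry L v (sg true)) v -
     gt_coef false L v * gt_coef true (shift_entry L v (sg false)) v).
Proof.
rewrite /residue_sum {1}/row_poles big_cat !big_map !big_enum /= -big_split /=.
apply: eq_bigr => v /eqP rv; rewrite residue_row // residue_row1 //.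
by rewrite addrC.
Qed.

Lemma sum_row1 r : (r < m)%N ->
  \sum_(w in [pred v : vertex m | vrow v == r]) 1 = r.+1%:R :> R[i].
Proof. by move=> rm; rewrite sumr_const card_row. Qed.

Lemma sum_row_poles_zeros L r : (r.+1 < m)%N ->
  \sum_(t <- row_poles L r) t - \sum_(t <- row_zeros L r) t =
  (r%:R + \sum_(w | vrow w == r) L w - \sum_(w | (vrow w).+1 == r) L w) -
  (r.+1%:R + \sum_(w | vrow w == r.+1) L w - \sum_(w | (vrow w).+1 == r.+1) L w).
Proof.
move=> rm; rewrite !big_cat !big_map !big_enum /= !big_split /=.
rewrite (sum_row1 rm) (sum_row1 (ltnW rm)).
rewrite -[r.+2%:R]natr1 -[r.+1%:R]natr1; ring.
Qed.

Lemma row_level_le1 (G : graph m) L r (t : R[i]) : admissible G -> noncritical G ->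
  realization G L -> (r.+1 < m)%N -> forall c : R[i],
  (#|[set v | [pred v : vertex m | vrow v == r] v & (L v + c == t)%R]| <= 1)%N.
Proof.
move=> adm ncr real rm c; apply/card_le1_eqP => u v; rewrite !inE.
move=> /andP[/eqP ru /eqP Lu] /andP[/eqP rv /eqP Lv].
have tu : ~~ top u by rewrite /top ru ltn_eqF.
apply: esym; apply: (realization_inj adm ncr real _ tu); first by rewrite ru rv.
by apply: (addIr c); rewrite Lu Lv.
Qed.

(** The entries of the row are distinct, so a repeated pole is double and comes from L u = L v + 1;
    its zeros are those of [zero_set]. *)
Lemma row_multiplicity (G : graph m) L r : admissible G -> noncritical G ->
  double_zeros R G -> realization G L -> (r.+1 < m)%N ->
  forall t, (1 < count_mem t (row_poles L r))%N ->
    (count_mem t (row_poles L r) <= count_mem t (row_zeros L r))%N.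
Proof.
move=> adm ncr dz real rm t; rewrite !count_cat !count_map_enum.
have le1 := row_level_le1 t adm ncr real rm.
have := le1 0; have := le1 1.
have -> : [set v | [pred v : vertex m | vrow v == r] v & L v + 0 == t] =
    [set v | [pred v : vertex m | vrow v == r] v & L v == t].
  by apply/setP => v; rewrite !inE addr0.
set A := [set _ | _ & _]; set B := [set _ | _ & _] => A1 B1 AB.
have B0 : (0 < #|B|)%N.
  by rewrite lt0n; apply/eqP => B0; move: AB; rewrite B0 add0n ltnNge A1.
have A0 : (0 < #|A|)%N.
  by rewrite lt0n; apply/eqP => A0; move: AB; rewrite A0 addn0 ltnNge B1.
apply: (leq_trans (leq_add B1 A1)).
move: B0 => /card_gt0P[u]; rewrite !inE => /andP[/eqP ru /eqP Lu].
move: A0 => /card_gt0P[v]; rewrite !inE => /andP[/eqP rv /eqP Lv].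
have Luv : L u - L v = 1 by rewrite Lu -Lv; ring.
have tu : ~~ top u by rewrite /top ru ltn_eqF.
apply: (leq_trans (dz L u v real _ tu Luv)); first by rewrite ru rv.
rewrite -cardsUI (leq_trans _ (leq_addr _ _)) // subset_leq_card //.
apply/subsetP => w; rewrite !inE ru => /orP[] /andP[-> /eqP ->] /=.
  by rewrite Lv eqxx.
by rewrite Lu eqxx orbT.
Qed.

End RowResidues.

Definition gt_weight (R : realType) (m : nat) (i : nat) (L : tableau R m) : R[i] :=
  i%:R + \sum_(w | vrow w == i) L w - \sum_(w | (vrow w).+1 == i) L w.

(** * The Chevalley relations on tableaux *)

Section ChevalleyRelations.

Variables (R : realType) (m : nat) (G : graph m).
Implicit Types (L : tableau R m) (u v w p : vertex m) (e : bool) (r i j : nat).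

Variables (V : lmodType R[i]) (T : tableau R m -> V) (valid : tableau R m -> Prop).
Variable gt_op : bool -> nat -> lin_end V.
Variable gt_cartan : nat -> lin_end V.

Hypothesis T_invalid : forall L, ~ valid L -> T L = 0.
Hypothesis valid_real : forall L, valid L -> realization G L.
Hypothesis valid_shift : forall e L v, valid L -> ~~ top v ->
  realization G (shift_entry L v (sg e)) -> valid (shift_entry L v (sg e)).
Hypothesis gt_opE : forall e r L, valid L -> gt_op e r (T L) = gt_step T e r L.
Hypothesis gt_cartanE : forall i L, valid L -> gt_cartan i (T L) = gt_weight i L *: T L.
Hypothesis T_ext : forall f g : lin_end V,
  (forall L, valid L -> f (T L) = g (T L)) -> f = g.
Hypothesis adm : admissible G.

Lemma gt_weight_shift e i L v :
  gt_weight i (shift_entry L v (sg e)) =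
  gt_weight i L + sg e *+ (vrow v == i) - sg e *+ ((vrow v).+1 == i).
Proof.
have sumS (P : pred (vertex m)) :
    \sum_(w | P w) shift_entry L v (sg e) w = \sum_(w | P w) L w + sg e *+ P v.
  under eq_bigr => w _ do rewrite shift_entryE.
  rewrite big_split /=; congr (_ + _); case: (boolP (P v)) => Pv.
    rewrite (bigD1 v) //= eqxx big1 ?addr0 // => w /andP[_ /negbTE ->].
    by rewrite mulr0n.
  by rewrite big1 // => w Pw; case: eqP Pv => [<-|]; rewrite ?Pw.
rewrite /gt_weight !sumS; ring.
Qed.

Lemma gt_cartan_op e i j : (i < m)%N -> (j.+1 < m)%N ->
  lin_end_br (gt_cartan i) (gt_op e j) =
  if e then gt_op e j *+ (i == j) - gt_op e j *+ (i == j.+1)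
  else gt_op e j *+ (i == j.+1) - gt_op e j *+ (i == j).
Proof.
move=> im jm; apply: T_ext => L vL /=.
have W M : gt_cartan i (T M) = gt_weight i M *: T M.
  have [vM|nvM] := pselect (valid M); first exact: gt_cartanE.
  by rewrite T_invalid // lin_end0 scaler0.
have -> : gt_cartan i (gt_op e j (T L)) - gt_op e j (gt_cartan i (T L)) =
    (sg e *+ (i == j) - sg e *+ (i == j.+1)) *: gt_op e j (T L).
  rewrite W lin_endZ (gt_opE e j vL) lin_end_sum !scaler_sumr -sumrB.
  apply: eq_bigr => v /eqP rv; rewrite lin_endZ W !scalerA -scalerBl; congr (_ *: _).
  rewrite gt_weight_shift rv [j == i]eq_sym [j.+1 == i]eq_sym; ring.
case: (e); rewrite /sg lin_end_addE lin_end_oppE !lin_end_mulrbE;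
  case: (i == j); case: (i == j.+1);
  by rewrite ?mulr1n ?mulr0n ?subr0 ?sub0r ?subrr ?scale0r ?opprK ?scale1r ?scaleN1r ?oppr0.
Qed.

Lemma gt_op_bracket i j : (i.+1 < m)%N -> (j.+1 < m)%N -> i != j ->
  lin_end_br (- gt_op true i) (gt_op false j) = 0.
Proof.
move=> im jm ij; apply: T_ext => L vL /=.
rewrite lin_endN.
rewrite (gt_op_comm T_invalid valid_real valid_shift gt_opE adm vL im jm ij) ?opprK ?addNr ?subrr //.
by left.
Qed.

Lemma gt_op_bracket_eq i L : valid L -> (i.+1 < m)%N ->
  lin_end_br (- gt_op true i) (gt_op false i) (T L) =
  residue_sum (row_poles L i) (row_zeros L i) *: T L.
Proof.
move=> vL im /=; rewrite lin_endN opprK addrC.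
have /= -> := gt_op_cartan T_invalid valid_real valid_shift gt_opE adm false vL im.
by rewrite residue_sum_row.
Qed.

Lemma gt_op_bracket_serre e ra rb : noncritical G -> double_zeros R G ->
  (ra.+1 < m)%N -> (rb.+1 < m)%N -> (rb == ra.+1) || (ra == rb.+1) ->
  lin_end_br (gt_op e ra) (lin_end_br (gt_op e ra) (gt_op e rb)) = 0.
Proof.
move=> ncr dz ram rbm adj; apply: T_ext => L vL /=; rewrite lin_endB opprB.
rewrite -[RHS](gt_op_serre T_invalid valid_real valid_shift gt_opE adm e ncr dz vL ram rbm adj).
by rewrite scaler_nat mulr2n opprD !addrA addrAC.
Qed.

(** The minus sign is the one in the Gelfand-Tsetlin formula for E_(k,k+1), which [gt_coef] leaves
    out. *)
Lemma gt_chevalley : noncritical G -> double_zeros R G ->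
  chevalley (@lin_end_br _ V) m (fun i => - gt_op true i) (gt_op false) gt_cartan.
Proof.
move=> ncr dz.
have lie := @lin_end_lie _ V.
split; first split.
- move=> i j im jm; have [<-|ij] := eqVneq i j; last by rewrite gt_op_bracket.
  apply: T_ext => L vL; rewrite gt_op_bracket_eq // mulr1n lin_end_addE lin_end_oppE.
  rewrite !gt_cartanE // -scalerBl residue_sumE ?size_row_zeros //.
    by rewrite sum_row_poles_zeros.
  exact: (row_multiplicity adm ncr dz (valid_real vL) im).
- move=> i j im jm; rewrite (brNr lie) (gt_cartan_op true) //.
  by rewrite !mulNrn opprB opprK addrC.
- by move=> i j im jm; rewrite (gt_cartan_op false).
- move=> i j im jm; apply: T_ext => L vL /=.
  by rewrite !gt_cartanE // !lin_endZ !gt_cartanE // !scalerA mulrC subrr.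
- move=> i j ij jm; have im : (i.+1 < m)%N by lia.
  have com e : lin_end_br (gt_op e i) (gt_op e j) = 0.
    apply: T_ext => L vL /=.
    rewrite (gt_op_comm T_invalid valid_real valid_shift gt_opE adm vL im jm) ?subrr //; first by lia.
    by right; lia.
  by rewrite (brNl lie) (brNr lie) !com !oppr0.
- move=> i im; have im1 : (i.+1 < m)%N by lia.
  have S e := @gt_op_bracket_serre e i i.+1 ncr dz im1 im.
  have S' e := @gt_op_bracket_serre e i.+1 i ncr dz im im1.
  by split; rewrite ?(brNl lie) ?(brNr lie) ?(brNl lie) ?S ?S' ?oppr0 ?eqxx ?orbT.
Qed.

End ChevalleyRelations.

(** * The operators of the Gelfand-Tsetlin formulas *)

Lemma scale_inj (K : fieldType) (V : lmodType K) (x : V) (c d : K) :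
  x != 0 -> c *: x = d *: x -> c = d.
Proof.
move=> nzx /eqP; rewrite -subr_eq0 -scalerBl scaler_eq0 (negbTE nzx) orbF subr_eq0.
by move=> /eqP.
Qed.

Lemma scale_opp_add (K : fieldType) (V : lmodType K) (x : V) (c d : K) :
  -1 *: (c *: x) + d *: x = (d - c) *: x.
Proof. by rewrite scaleN1r addrC -scalerBl. Qed.

Lemma malg_decomp (K : nzRingType) (B : choiceType) (x : {malg K[B]}) :
  x = \sum_(b <- msupp x) x@_b *: << b >>.
Proof.
rewrite {1}[x]monalgE; apply: eq_bigr => b _; apply/malgP => b'.
by rewrite mcoeffZ !mcoeffU; case: (b == b'); rewrite ?mulr1n ?mulr0n ?mulr1 ?mulr0.
Qed.

Section TableauVectors.

Variables (R : realType) (m : nat) (G : graph m) (L0 : tableau R m).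
Implicit Types (L : tableau R m) (u v w : vertex m) (e : bool) (r : nat).

Local Notation V := (VG G L0).
Local Notation T := (tableau_vector G L0).
Local Notation K := R[i].

Definition gt_valid L : Prop := realization G L /\ integral_shift L0 L.

Definition lin_ext_fun (F : tableau R m -> V) (x : V) : V :=
  \sum_(b <- msupp x) x@_b *: F (val b).

Lemma lin_ext_funEw F (D : {fset VGbasis G L0}) x : (msupp x `<=` D)%fset ->
  lin_ext_fun F x = \sum_(b <- D) x@_b *: F (val b).
Proof.
move=> xD; apply: big_fset_incl => // b _ bx.
by rewrite mcoeff_outdom // scale0r.
Qed.

Lemma lin_ext_linear F : linear (lin_ext_fun F).
Proof.
move=> c x y; pose D := (msupp (c *: x + y)%R `|` (msupp x `|` msupp y))%fset.
have h1 : (msupp (c *: x + y)%R `<=` D)%fset by rewrite fsubsetUl.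
have h2 : (msupp x `<=` D)%fset.
  by rewrite (fsubset_trans (fsubsetUl _ (msupp y))) // fsubsetUr.
have h3 : (msupp y `<=` D)%fset.
  by rewrite (fsubset_trans (fsubsetUr (msupp x) _)) // fsubsetUr.
rewrite (lin_ext_funEw F h1) (lin_ext_funEw F h2) (lin_ext_funEw F h3).
rewrite scaler_sumr -big_split /=; apply: eq_bigr => b _.
by rewrite mcoeffD mcoeffZ scalerDl scalerA.
Qed.

Definition lin_ext F : lin_end V := LinEnd (lin_ext_linear F).

Lemma lin_ext_basis F b : lin_ext F (basis_vector b) = F (val b).
Proof.
rewrite /= /lin_ext_fun /basis_vector msuppU oner_eq0 big_seq_fset1.
by rewrite mcoeffUU scale1r.
Qed.

Lemma lin_end_basis_ext (f g : lin_end V) :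
  (forall b, f (basis_vector b) = g (basis_vector b)) -> f = g.
Proof.
move=> fg; apply: lin_end_ext => x; rewrite [x]malg_decomp !lin_end_sum.
by apply: eq_bigr => b _; rewrite !lin_endZ fg.
Qed.

Lemma basis_vector_neq0 (b : VGbasis G L0) : basis_vector b != 0.
Proof. by rewrite monalgU_eq0 oner_eq0. Qed.

Lemma tableau_vector_basis (b : VGbasis G L0) : T (val b) = basis_vector b.
Proof. by rewrite /tableau_vector valK. Qed.

Lemma tableau_vector_invalid L : ~ gt_valid L -> T L = 0.
Proof.
move=> nv; rewrite /tableau_vector; case: insubP => // b Lb bE.
by case: nv; apply/asboolP.
Qed.

Lemma gt_valid_basis L : gt_valid L -> exists b : VGbasis G L0, val b = L.
Proof. by move=> vL; exists (VGBasis (asboolT vL)). Qed.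

Lemma basis_valid (b : VGbasis G L0) : gt_valid (val b).
Proof. by apply/asboolP; case: b. Qed.

Lemma lin_ext_tableau F L : gt_valid L -> lin_ext F (T L) = F L.
Proof. by move=> /gt_valid_basis[b <-]; rewrite tableau_vector_basis lin_ext_basis. Qed.

Lemma gt_valid_shift e L v : gt_valid L -> ~~ top v ->
  realization G (shift_entry L v (sg e)) -> gt_valid (shift_entry L v (sg e)).
Proof.
move=> [_ [z [ztop zE]]] tv real; split=> //.
exists [ffun w => z w + (if e then 1 else -1 : int) *+ (w == v)]; split=> w.
  by move=> tw; rewrite ffunE ztop // add0r; case: eqP tw tv => // -> ->.
by rewrite shift_entryE ffunE zE sgE intrD addrA; case: eqP.
Qed.

Lemma GT_raiseE r L : GT_raise G L0 r L = - gt_step T true r L.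
Proof.
apply: (congr1 (fun x : V => - x)); apply: eq_bigr => v /eqP rv.
by rewrite /gt_coef /nb /sg rv.
Qed.

Lemma GT_lowerE r L : GT_lower G L0 r L = gt_step T false r L.
Proof. by apply: eq_bigr => v /eqP rv; rewrite /gt_coef /nb /sg rv. Qed.

Definition gt_op e r : lin_end V := lin_ext (gt_step T e r).
Definition gt_cartan i : lin_end V := lin_ext (GT_diag G L0 i).

Lemma gt_opE e r L : gt_valid L -> gt_op e r (T L) = gt_step T e r L.
Proof. exact: lin_ext_tableau. Qed.

Lemma gt_cartanE i L : gt_valid L -> gt_cartan i (T L) = gt_weight i L *: T L.
Proof. exact: lin_ext_tableau. Qed.

Lemma tableau_vector_ext (f g : lin_end V) :
  (forall L, gt_valid L -> f (T L) = g (T L)) -> f = g.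
Proof.
move=> fg; apply: lin_end_basis_ext => b; rewrite -tableau_vector_basis.
by apply: fg; apply: basis_valid.
Qed.

Lemma gt_valid_real L : gt_valid L -> realization G L.
Proof. by case. Qed.

Lemma GT_formulas_of_chevalley :
  chevalley (@lin_end_br _ V) m (fun i => - gt_op true i) (gt_op false) gt_cartan ->
  GT_formulas_define_module G L0.
Proof.
move=> ch; have nz2 : 2%:R != 0 :> R[i] by rewrite pnatr_eq0.
have [rho [glm rE rF rH]] := gl_module_of_chevalley nz2 ch.
exists rho; split=> // i.
- move=> j b ij; rewrite (rE i j ij) lin_end_oppE -tableau_vector_basis.
  by rewrite gt_opE ?GT_raiseE //; apply: basis_valid.
- move=> j b ij; rewrite (rF i j ij) -tableau_vector_basis.
  by rewrite gt_opE ?GT_lowerE //; apply: basis_valid.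
- by move=> b; rewrite (rH i) lin_ext_basis.
Qed.

Hypothesis adm : admissible G.

(** Both sides are the scalar by which [E, F] acts on the nonzero vector T(L): one by the formulas
    for E and F, the other by those for the diagonal matrix units. *)
Lemma residue_sum_of_module L (r : nat) : GT_formulas_define_module G L0 ->
  gt_valid L -> (r.+1 < m)%N ->
  residue_sum (row_poles L r) (row_zeros L r) =
  \sum_(t <- row_poles L r) t - \sum_(t <- row_zeros L r) t.
Proof.
move=> [rho [[lin linA brk] rE rF rH]] vL rm.
pose i := Ordinal (ltnW rm); pose j := Ordinal rm.
pose E := LinEnd (lin (delta_mx i j)); pose F := LinEnd (lin (delta_mx j i)).
have EE : E = - gt_op true r.
  apply: lin_end_basis_ext => b; rewrite lin_end_oppE -tableau_vector_basis.
  rewrite gt_opE; last exact: basis_valid.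
  by rewrite -GT_raiseE tableau_vector_basis; apply: (rE i j b).
have FE : F = gt_op false r.
  apply: lin_end_basis_ext => b; rewrite -[in RHS]tableau_vector_basis.
  rewrite gt_opE; last exact: basis_valid.
  by rewrite -GT_lowerE; apply: (rF i j b).
have brE := gt_op_bracket_eq tableau_vector_invalid gt_valid_real gt_valid_shift
  gt_opE adm vL rm.
have [b bL] := gt_valid_basis vL.
(* Written as [c *: A + B], the shape in which [gl_module] states linearity. *)
have M : delta_mx i j *m delta_mx j i - delta_mx j i *m delta_mx i j =
    (-1) *: delta_mx j j + delta_mx i i :> 'M[R[i]]_m.
  by rewrite !mul_delta_mx scaleN1r addrC.
have bE : lin_end_br E F (basis_vector b) =
    (gt_weight r L - gt_weight r.+1 L) *: basis_vector b.
  have := brk (delta_mx i j) (delta_mx j i) (basis_vector b).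
  rewrite M linA !rH => H; rewrite -[LHS]H /GT_diag tableau_vector_basis bL.
  exact: scale_opp_add.
move: bE; rewrite EE FE -{1}tableau_vector_basis bL brE -bL tableau_vector_basis.
move=> /(scale_inj (basis_vector_neq0 b)) ->.
by rewrite sum_row_poles_zeros.
Qed.

End TableauVectors.

Theorem relation_graph_of_double_zeros (R : realType) (m : nat) (G : graph m) :
  admissible G -> noncritical G -> double_zeros R G -> relation_graph R G.
Proof.
move=> adm ncr dz; split=> // L0 _; apply: GT_formulas_of_chevalley.
exact: (gt_chevalley (@tableau_vector_invalid R m G L0) (@gt_valid_real R m G L0)
  (@gt_valid_shift R m G L0) (@gt_opE R m G L0) (@gt_cartanE R m G L0)
  (@tableau_vector_ext R m G L0) adm ncr dz).
Qed.

(** * Relation graphs have double zeros *)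

Section Stretch.

Variables (R : realType) (c : R[i]).
Implicit Types x y : R[i].

(** [c] and [c + 1] both get 0, so their distance is kept. On the classes modulo the integers that
    avoid [c], the floor of the real part grows as fast as its argument. *)
Definition stretch (x : R[i]) : int :=
  match pselect (exists z : int, x - c = z%:~R) with
  | left H => let z := projT1 (cid H) in if 1 <= z then z - 1 else z
  | right _ => Num.floor (complex.Re x)
  end.

Lemma stretch_class x (z : int) : x - c = z%:~R ->
  stretch x = if 1 <= z then z - 1 else z.
Proof.
move=> xz; rewrite /stretch; case: pselect => [H|[]]; last by exists z.
by case: cid => y /=; rewrite xz => /intr_inj ->.
Qed.

(* [x + stretch x] doubles integral differences, less 1 for those that        *)
(* contain the step from [c] to [c + 1].                                      *)
Lemma stretch_mono x y (n : int) : x - y = n%:~R -> 0 <= n ->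
  0 <= stretch x - stretch y /\ (stretch x = stretch y -> n = 0 \/ n = 1 /\ y = c).
Proof.
move=> xy n0; have [[z yz]|no] := pselect (exists z : int, y - c = z%:~R).
  have xz : x - c = (z + n)%:~R by rewrite intrD -yz -xy; ring.
  rewrite (stretch_class xz) (stretch_class yz).
  have yc : z = 0 -> y = c by move=> z0; apply/eqP; rewrite -subr_eq0 yz z0.
  have [h1|h1] := lerP 1 (z + n); have [h2|h2] := lerP 1 z.
  - by split=> [|E]; [lia | left; lia].
  - split; first by lia.
    by move=> E; right; split; [lia | apply: yc; lia].
  - by split=> [|E]; [lia | left; lia].
  - by split=> [|E]; [lia | left; lia].
have nox : ~ exists z : int, x - c = z%:~R.
  move=> [z xz]; apply: no; exists (z - n); rewrite intrB -xz -xy; ring.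
rewrite /stretch; case: pselect => // _; case: pselect => // _.
have -> : complex.Re x = complex.Re y + n%:~R.
  have -> : x = y + n%:~R by rewrite -xy; ring.
  by rewrite -(rmorph_int (real_complex R)); case: (y).
rewrite floorDrz ?intr_int // intrKfloor addrAC subrr add0r; split=> // E; left.
by apply: (addrI (Num.floor (complex.Re y))); rewrite addr0.
Qed.

End Stretch.

Section Extract.

Variables (R : realType) (m : nat) (G : graph m).
Implicit Types (L : tableau R m) (u v w : vertex m).

Definition stretch_tableau (c : R[i]) L : tableau R m :=
  [ffun w => L w + (stretch c (L w))%:~R].

Lemma stretch_realization c L : realization G L -> realization G (stretch_tableau c L).
Proof.
move=> real; have LE w : stretch_tableau c L w = L w + (stretch c (L w))%:~R by rewrite ffunE.
apply: (realization_shift LE real) => u v z _ zE zge.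
have z0 : 0 <= z by apply: le_trans zge.
have [ge0 _] := stretch_mono c zE z0; lia.
Qed.

Lemma stretch_gap c L u v : stretch_tableau c L u - stretch_tableau c L v = 1 ->
  L v = c /\ L u = c + 1.
Proof.
rewrite !ffunE => E.
pose n := 1 + stretch c (L v) - stretch c (L u).
have uv : L u - L v = n%:~R.
  by rewrite /n intrB intrD -[1%:~R]E; ring.
have vu : L v - L u = (- n)%:~R by rewrite intrN -uv; ring.
have [n0|n0] := leP 0 n; last first.
  have [|ge0 _] := stretch_mono c vu; lia.
have [ge0 eq0] := stretch_mono c uv n0.
have n1 : n <> 0 by move=> n1; have [|ge0' _] := stretch_mono c vu; lia.
have [//|//|[nE vc]] := eq0; first by lia.
by split=> //; rewrite -[L u](subrK (L v)) uv nE vc addrC.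
Qed.

Lemma stretch_inj c L u v : stretch_tableau c L u = stretch_tableau c L v -> L u = L v.
Proof.
move=> E; pose n := stretch c (L v) - stretch c (L u).
have uv : L u - L v = n%:~R.
  have aux (x y a b : R[i]) : x + a = y + b -> x - y = b - a.
    by move=> /(canRL (addrK _)) ->; ring.
  by move: E; rewrite !ffunE /n intrB => /aux.
have vu : L v - L u = (- n)%:~R by rewrite intrN -uv; ring.
suff n0 : n = 0 by apply/eqP; rewrite -subr_eq0 uv n0.
have [n0|n0] := lerP 0 n; first by have [ge0 _] := stretch_mono c uv n0; lia.
by have [|ge0 _] := stretch_mono c vu; lia.
Qed.

(** Stretching at [L v] leaves [u], [v] as the only pair of the row at distance 1, so t is the only
    repeated pole and is double. One zero at t comes from [zero_set_neq0]; it is cancelled, and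
    [residue_sum_double_pole] finds another. *)
Theorem relation_graph_double_zeros : relation_graph R G -> double_zeros R G.
Proof.
move=> [adm ncr mods] L u v real ruv tu Luv.
pose L' := stretch_tableau (L v) L; pose r := vrow u; pose t := L' u.
have real' : realization G L' by apply: stretch_realization.
have rm : (r.+1 < m)%N by rewrite ltn_neqAle vrow_lt andbT; apply: tu.
have Luv' : L' u - L' v = 1.
  rewrite !ffunE (stretch_class (z := 1)) // (stretch_class (z := 0)) ?subrr //=.
  by rewrite ?subrr ?mulr0z !addr0.
(* Equal entries of [L'] are equal in [L], so zeros may be counted in [L']. *)
have sub : zero_set L' u v \subset zero_set L u v.
  apply/subsetP => w; rewrite !inE => /orP[] /andP[-> /eqP/stretch_inj ->];
    by rewrite eqxx ?orbT.
apply: leq_trans (subset_leq_card sub).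
have val' : gt_valid G L' L'.
  split=> //; exists [ffun=> 0]; split=> [w _|w]; first by rewrite ffunE.
  have -> : [ffun=> 0] w = 0 :> int by rewrite ffunE.
  by rewrite mulr0z addr0.
have res := residue_sum_of_module adm (mods L' real') val' rm.
have pd : count_mem t (row_poles L' r) = 2%N.
  rewrite count_cat !count_map_enum.
  have -> : [set w | [pred v : vertex m | vrow v == r] w & L' w == t] = [set u].
    apply/setP => w; rewrite !inE; apply/andP/eqP => [[/eqP rw /eqP Lw]|->] //.
    by apply/esym; apply: (realization_inj adm ncr real' (esym rw) tu).
  have -> : [set w | [pred v : vertex m | vrow v == r] w & L' w + 1 == t] = [set v].
    apply/setP => w; rewrite !inE /t; have -> : L' u = L' v + 1 by rewrite -Luv'; ring.
    rewrite (inj_eq (addIr _)); apply/andP/eqP => [[/eqP rw /eqP Lw]|->]; last first.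
      by rewrite -ruv !eqxx.
    have tv : ~~ top v by move: tu; rewrite /top ruv.
    by apply/esym; apply: (realization_inj adm ncr real' _ tv) => //; rewrite rw -ruv.
  by rewrite !cards1.
have pd' x : x != t -> (count_mem x (row_poles L' r) <= 1)%N.
  move=> xt; rewrite count_cat !count_map_enum.
  have := row_level_le1 x adm ncr real' rm 1.
  have := row_level_le1 x adm ncr real' rm 0.
  have -> : [set w | [pred v : vertex m | vrow v == r] w & L' w + 0 == x] =
      [set w | [pred v : vertex m | vrow v == r] w & L' w == x].
    by apply/setP => w; rewrite !inE addr0.
  set A := [set _ | _ & _]; set B := [set _ | _ & _] => A1 B1.
  have [A0|/set0Pn[a]] := eqVneq A set0; first by rewrite A0 cards0.
  have [B0|/set0Pn[b]] := eqVneq B set0; first by rewrite B0 cards0 addn0.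
  rewrite !inE => /andP[_ /eqP Lb] /andP[/eqP ra /eqP La].
  have [|Lb' La'] := @stretch_gap (L v) L a b; first by rewrite -/L' La -Lb; ring.
  case/eqP: xt; rewrite -La /t; congr (L' _).
  have ta : ~~ top a by rewrite /top ra ltn_eqF.
  by apply: (realization_inj adm ncr real _ ta); rewrite // La' -Luv; ring.
have zs : count_mem t (row_zeros L' r) = #|zero_set L' u v|.
  rewrite count_cat !count_map_enum -cardsUI [_ :&: _](_ : _ = set0).
    rewrite cards0 addn0; apply: eq_card => w; rewrite !inE -/r; congr (_ && _ || _).
    have -> : t = L' v + 1 by rewrite /t -Luv'; ring.
    by rewrite (inj_eq (addIr _)).
  apply/setP => w; rewrite !inE; apply/negP => /andP[/andP[/eqP r1 _] /andP[/eqP r2 _]].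
  by move: r1 r2; lia.
have td : t \in row_poles L' r by rewrite -has_pred1 has_count pd.
have ts : t \in row_zeros L' r.
  rewrite -has_pred1 has_count zs; apply/card_gt0P.
  exact: (zero_set_neq0 adm ncr real' ruv tu Luv').
have ptd := perm_to_rem td; have pts := perm_to_rem ts.
have cd := seq.permP ptd; have cs := seq.permP pts.
rewrite -zs cs /= eqxx add1n ltnS -has_count has_pred1.
apply: (@residue_sum_double_pole _ (rem t (row_poles L' r))).
- by rewrite -has_pred1 has_count; move: pd; rewrite cd /= eqxx; case: count.
- apply: count_mem_uniq => x.
  have : (count_mem x (rem t (row_poles L' r)) <= 1)%N.
    have [->|xt] := eqVneq x t; first by move: pd; rewrite cd /= eqxx add1n => -[->].
    by apply: leq_trans (pd' x xt); rewrite cd /= leq_addl.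
  by rewrite -has_pred1 has_count; case: count => [|[]].
- by rewrite !size_rem // size_row_zeros.
- rewrite -(residue_sum_perm ptd pts) res (perm_big _ ptd) [X in _ - X](perm_big _ pts) /=.
  by rewrite !big_cons opprD addrACA subrr add0r.
Qed.

End Extract.

(** * Tableau graphs *)

Section TableauGraph.

Variables (R : realType) (m : nat) (L : tableau R m).
Implicit Types u v w : vertex m.

Local Notation full := (full_tableau_graph L).
Local Notation TG := (tableau_graph L).

Lemma connect_tableau_graph u v : connect (arrow TG) u v = connect (arrow full) u v.
Proof.
have /minsetP[/forallP/(_ u)/forallP/(_ v)/eqP -> _] := tableau_graphP L.
by [].
Qed.

Lemma tableau_graph_arrow u v : arrow TG u v =
  [&& u != v, connect (arrow full) u v &
    [forall w, connect (arrow full) u w && connect (arrow full) w v ==>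
      (w == u) || (w == v)]].
Proof. exact: transitive_reduction_arrow (@full_tableau_graph_acyclic _ _ L) (tableau_graphP L) u v. Qed.

Lemma full_arrowP u v : reflect
  [\/ vrow u = (vrow v).+1 /\ is_nat (L u - L v),
      vrow v = (vrow u).+1 /\ is_posnat (L u - L v)
    | [/\ top u, top v, u != v, is_nat (L u - L v) & L u = L v -> (vcol u < vcol v)%N]]
  (arrow full u v).
Proof. by rewrite /arrow inE; apply: asboolP. Qed.

Lemma full_arrow_irr u : arrow full u u = false.
Proof. by apply/negP => /full_arrowP[[]|[]|[_ _]]; [lia | lia | rewrite eqxx]. Qed.

Lemma full_arrow_int u v : arrow full u v -> is_int (L u - L v).
Proof.
by case/full_arrowP => [[_ [n ->]]|[_ [n ->]]|[_ _ _ [n ->] _]];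
  [exists n%:Z | exists n.+1%:Z | exists n%:Z].
Qed.

Lemma tableau_graph_sub u v : arrow TG u v -> arrow full u v.
Proof.
rewrite tableau_graph_arrow => /and3P[uv /connectP[[|w p] /=]].
  by move=> _ vE; rewrite vE eqxx in uv.
move=> /andP[uw wp] vE /forallP/(_ w).
have wv : connect (arrow full) w v by apply/connectP; exists p.
rewrite (connect1 uw) wv /= => /orP[/eqP wu|/eqP <- //].
by rewrite wu full_arrow_irr in uw.
Qed.

Lemma tableau_graph_admissible : admissible TG.
Proof.
split=> [u v /tableau_graph_sub/full_arrowP[[-> _]|[-> _]|[-> -> _ _ _]]|].
- by rewrite eqxx.
- by rewrite eqxx orbT.
- by rewrite !orbT.
case=> // x p /=; case: p => [|y p] /=.
  by rewrite andbT => /tableau_graph_sub; rewrite full_arrow_irr.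
move=> /andP[xy yp]; have yx : connect (arrow full) y x.
  rewrite -connect_tableau_graph; apply/connectP; exists (rcons p x) => //.
  by rewrite last_rcons.
have xy' := connect1 (tableau_graph_sub xy).
have := @full_tableau_graph_acyclic _ _ L x y; rewrite xy' yx => /(_ isT) E.
by move: xy; rewrite E => /tableau_graph_sub; rewrite full_arrow_irr.
Qed.

End TableauGraph.

Section Corner.

Variables (R : realType) (d k : nat).

Fact corner_subproof (u : vertex k) :
  (rshift d (vcol u) <= rshift d (val u).1)%N.
Proof. by rewrite /= leq_add2l; apply: vcol_le. Qed.

Definition corner (u : vertex k) : vertex (d + k) :=
  @Vertex (d + k) (rshift d (val u).1, rshift d (vcol u)) (corner_subproof u).

Lemma vrow_corner u : vrow (corner u) = (d + vrow u)%N. Proof. by []. Qed.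
Lemma vcol_corner u : vcol (corner u) = rshift d (vcol u). Proof. by []. Qed.

Lemma corner_inj : injective corner.
Proof.
move=> u v uv; apply: vertex_eq; first by apply: (@addnI d); rewrite -!vrow_corner uv.
by apply: (@rshift_inj d); rewrite -!vcol_corner uv.
Qed.

Lemma top_corner u : top (corner u) = top u.
Proof. by rewrite /top vrow_corner -addnS eqn_add2l. Qed.

Definition in_corner (x : vertex (d + k)) : bool := (d <= vcol x)%N.

Lemma in_cornerP x : reflect (exists u, x = corner u) (in_corner x).
Proof.
apply: (iffP idP) => [dx|[u ->]]; last by rewrite /in_corner vcol_corner leq_addr.
have cx := vcol_le x; have rx := vrow_lt x.
have [||u ru cu] := @vertex_ex k (vrow x - d) (vcol x - d).
- exact: leq_sub2r.
- by rewrite ltn_subLR // (leq_trans dx).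
exists u; apply: vertex_eq; first by rewrite vrow_corner ru subnKC // (leq_trans dx).
by apply: val_inj; rewrite /= cu subnKC.
Qed.

Variables (L : tableau R (d + k)) (Lc : tableau R k).
Hypothesis L_corner : forall u, L (corner u) = Lc u.
Hypothesis L_sep : forall x y, is_int (L x - L y) ->
  vcol x = vcol y \/ in_corner x /\ in_corner y.

Local Notation G := (tableau_graph L).
Local Notation H := (tableau_graph Lc).

Lemma full_arrow_corner u v :
  arrow (full_tableau_graph L) (corner u) (corner v) = arrow (full_tableau_graph Lc) u v.
Proof.
apply/full_arrowP/full_arrowP; rewrite !L_corner !top_corner !vrow_corner !vcol_corner.
  move=> [[ru N]|[rv P]|[tu tv uv N C]]; [apply: Or31|apply: Or32|apply: Or33].
  - by split=> //; apply: (@addnI d); rewrite addnS.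
  - by split=> //; apply: (@addnI d); rewrite addnS.
  - split=> //; first by apply: contraNneq uv => ->.
    by move/C; rewrite ltn_add2l.
move=> [[ru N]|[rv P]|[tu tv uv N C]]; [apply: Or31|apply: Or32|apply: Or33].
- by rewrite ru addnS.
- by rewrite rv addnS.
- split=> //; first by rewrite (inj_eq corner_inj).
  by move/C; rewrite /= ltn_add2l.
Qed.

(** An arrow joins entries at an integral distance, so [L_sep] keeps it inside or outside the
    corner. *)
Lemma arrow_in_corner x y : arrow (full_tableau_graph L) x y -> in_corner x = in_corner y.
Proof. by move=> /full_arrow_int/L_sep[|[-> ->]] //; rewrite /in_corner => ->. Qed.

Lemma connect_corner u x : connect (arrow (full_tableau_graph L)) (corner u) x ->
  exists2 v, x = corner v & connect (arrow (full_tableau_graph Lc)) u v.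
Proof.
move=> /connectP[p]; elim: p u => [|y p IH] u /=; first by move=> _ ->; exists u.
move=> /andP[uy yp] xE.
have /in_cornerP[v vE] : in_corner y.
  by rewrite -(arrow_in_corner uy); apply/in_cornerP; exists u.
rewrite vE full_arrow_corner in uy; rewrite vE in yp xE.
have [w wE vw] := IH v yp xE; exists w => //.
exact: connect_trans (connect1 uy) vw.
Qed.

Lemma connect_cornerE u v : connect (arrow (full_tableau_graph L)) (corner u) (corner v) =
  connect (arrow (full_tableau_graph Lc)) u v.
Proof.
apply/idP/idP => [/connect_corner[w /corner_inj -> //]|].
move=> /connectP[p]; elim: p u => [|y p IH] u /=; first by move=> _ ->.
move=> /andP[uy yp] vE; apply: connect_trans (IH y yp vE).
by apply: connect1; rewrite full_arrow_corner.
Qed.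

Lemma arrow_corner u v : arrow G (corner u) (corner v) = arrow H u v.
Proof.
rewrite !tableau_graph_arrow connect_cornerE (inj_eq corner_inj).
congr [&& _, _ & _]; apply/forallP/forallP => h w.
  by have := h (corner w); rewrite !connect_cornerE !(inj_eq corner_inj).
apply/implyP => /andP[/connect_corner[w' -> uw']].
rewrite connect_cornerE !(inj_eq corner_inj) => w'v.
by have := h w'; rewrite uw' w'v.
Qed.

Lemma same_component_corner u x : same_component G (corner u) x ->
  exists2 v, x = corner v & same_component H u v.
Proof.
move=> /connectP[p]; elim: p u => [|y p IH] u /=; first by move=> _ ->; exists u => //; apply: connect0.
move=> /andP[uy yp] xE.
have /in_cornerP[v vE] : in_corner y.
  have cu : in_corner (corner u) by apply/in_cornerP; exists u.
  by case/orP: uy => /tableau_graph_sub/arrow_in_corner; rewrite cu => // <-.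
rewrite vE !arrow_corner in uy; rewrite vE in yp xE.
have [w wE vw] := IH v yp xE; exists w => //.
by apply: connect_trans vw; apply: connect1.
Qed.

Lemma same_component_outside x y : same_component G x y -> ~~ in_corner x ->
  vcol x = vcol y.
Proof.
move=> /connectP[p]; elim: p x => [|z p IH] x /=; first by move=> _ ->.
move=> /andP[xz zp] yE nx.
have [cxz nz] : vcol x = vcol z /\ ~~ in_corner z.
  case/orP: xz => /tableau_graph_sub a; have := arrow_in_corner a;
    have [e|[cx cz]] := L_sep (full_arrow_int a).
  - by move=> <-.
  - by rewrite cx in nx.
  - by move=> ->.
  - by rewrite cz in nx.
by rewrite cxz; apply: IH.
Qed.

Lemma same_component_row x y : vrow x = vrow y -> same_component G x y ->
  x = y \/ exists u v, [/\ x = corner u, y = corner v & same_component H u v].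
Proof.
move=> rxy sc; have [/in_cornerP[u xE]|nx] := boolP (in_corner x).
  rewrite xE in sc; have [v yE uv] := same_component_corner sc.
  by right; exists u, v.
by left; apply: vertex_eq => //; apply: same_component_outside.
Qed.

Theorem relation_graph_corner : relation_graph R H -> relation_graph R G.
Proof.
move=> relH; have dzH := relation_graph_double_zeros relH.
have [admH ncrH _] := relH.
apply: relation_graph_of_double_zeros; first exact: tableau_graph_admissible.
- move=> x y rxy tx sc.
  have [<-|[u [v [xE yE uv]]]] := same_component_row rxy sc; first by rewrite connect0.
  rewrite xE yE !connect_tableau_graph !connect_cornerE -!connect_tableau_graph.
  apply: ncrH => //; last by rewrite -top_corner -xE.
  by apply: (@addnI d); rewrite -!vrow_corner -xE -yE.
- move=> L1 x y real1 rxy tx Lxy.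
  have sc : same_component G x y by apply: (proj2 real1) => //; exists 1.
  have [xy|[u [v [xE yE uv]]]] := same_component_row rxy sc.
    by move/eqP: Lxy; rewrite xy subrr eq_sym oner_eq0.
  (* The corner of a realization of [G] is a realization of [H], because [H] has the arrows and the
     components of [G] there. *)
  pose L2 : tableau R k := [ffun w => L1 (corner w)].
  have L2E w : L2 w = L1 (corner w) by rewrite ffunE.
  have rowS p q : (vrow (corner p) == (vrow (corner q)).+1) = (vrow p == (vrow q).+1).
    by rewrite !vrow_corner -addnS eqn_add2l.
  have real2 : realization H L2.
    split=> [p q pq|p q rpq tp]; rewrite !L2E.
      by have := (proj1 real1) (corner p) (corner q); rewrite arrow_corner rowS => /(_ pq).
    move=> /(proj2 real1); rewrite !vrow_corner rpq top_corner tp => /(_ erefl isT).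
    by move=> /same_component_corner[w /corner_inj ->].
  have ruv : vrow u = vrow v.
    by apply: (@addnI d); rewrite -!vrow_corner -xE -yE.
  have tu : ~~ top u by rewrite -top_corner -xE.
  have Luv : L2 u - L2 v = 1 by rewrite !L2E -xE -yE.
  apply: leq_trans (dzH L2 u v real2 ruv tu Luv) _.
  rewrite -(card_imset _ corner_inj) subset_leq_card //.
  apply/subsetP => _ /imsetP[w + ->].
  by rewrite !inE xE yE rowS [(vrow (corner w)).+1 == _]eq_sym rowS !L2E [vrow u == _]eq_sym.
Qed.

End Corner.

(** * Block permutations *)

Lemma Tsigma_nat (R : realType) (m : nat) (sigma : 'S_m) (X : 'I_m -> R[i]) v :
  exists n : nat, Tsigma sigma X v = X ((sigma^-1)%g (vcol v)) + n%:R.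
Proof.
rewrite ffunE; elim: (_ - _)%N => [|d [n IH]] /=; first by exists 0%N; rewrite addr0.
by rewrite IH; case: ifP => _; [exists n | exists n.+1; rewrite -natr1 addrA].
Qed.

(** The purpose of the shifts in mu_A: restriction to the indices in A commutes with the bar. *)
Lemma bar_mu_weight (R : realType) (n k : nat) (lambda : 'I_n -> R[i]) (a : 'I_k -> 'I_n) i :
  bar_weight (mu_weight lambda a) i = bar_weight lambda (a i).
Proof.
by rewrite /bar_weight /mu_weight -[(a i).+1%:R]natr1 -[i.+1%:R]natr1; ring.
Qed.

Section Permutations.

Variables (R : realType) (d k : nat) (lambda : 'I_(d + k) -> R[i]).
Variables (a : 'I_k -> 'I_(d + k)) (c : 'I_d -> 'I_(d + k)).
Hypothesis a_incr : forall i j : 'I_k, (i < j)%N -> (a i < a j)%N.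
Hypothesis c_inj : injective c.
Hypothesis c_out : forall i j, c j != a i.
Hypothesis lambda_a : forall i j : 'I_(d + k), i != j -> is_int (lambda i - lambda j) ->
  (exists s, i = a s) /\ (exists s, j = a s).

Lemma a_lt i j : (a i < a j)%N = (i < j)%N.
Proof.
case: (ltngtP i j) => [/a_incr -> //|/a_incr ji|/val_inj ->]; last by rewrite ltnn.
by apply/negbTE; rewrite -leqNgt ltnW.
Qed.

Lemma a_inj : injective a.
Proof.
move=> i j ij; apply: val_inj; have := a_lt i j; have := a_lt j i.
by rewrite ij ltnn; case: ltngtP.
Qed.

(** The inverse of the permutation sought: T_sigma puts the entry of index sigma^-1(s) on top of
    column s. *)
Definition block_fun (tau : 'S_k) (rho : 'S_d) (x : 'I_(d + k)) : 'I_(d + k) :=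
  match split x with inl j => c (rho j) | inr s => a ((tau^-1)%g s) end.

Lemma block_funl tau rho j : block_fun tau rho (lshift k j) = c (rho j).
Proof. by rewrite /block_fun -[lshift k j]/(unsplit (inl _)) unsplitK. Qed.

Lemma block_funr tau rho s : block_fun tau rho (rshift d s) = a ((tau^-1)%g s).
Proof. by rewrite /block_fun -[rshift d s]/(unsplit (inr _)) unsplitK. Qed.

Lemma block_fun_inj tau rho : injective (block_fun tau rho).
Proof.
move=> x y; rewrite -[x]splitK -[y]splitK.
case: (split x) => i; case: (split y) => j /=; rewrite ?block_funl ?block_funr.
- by move=> /c_inj/perm_inj ->.
- by move=> E; case/eqP: (c_out ((tau^-1)%g j) (rho i)).
- by move=> E; case/eqP: (c_out ((tau^-1)%g i) (rho j)).
- by move=> /a_inj/perm_inj ->.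
Qed.

(* The k entries indexed by A are sent to the last k columns, where [tau]     *)
(* arranges them; the others are arranged arbitrarily in the first columns.   *)
Definition block_perm (tau : 'S_k) (rho : 'S_d) : 'S_(d + k) :=
  ((perm (@block_fun_inj tau rho))^-1)%g.

Lemma block_permV tau rho x : ((block_perm tau rho)^-1)%g x = block_fun tau rho x.
Proof. by rewrite invgK permE. Qed.

Lemma block_perm_inj : injective (fun p : 'S_k * 'S_d => block_perm p.1 p.2).
Proof.
move=> [tau rho] [tau' rho'] /= E.
have E' x : block_fun tau rho x = block_fun tau' rho' x by rewrite -!block_permV E.
congr (_, _).
  apply: (inv_inj invgK); apply/permP => s.
  by apply: a_inj; have := E' (rshift d s); rewrite !block_funr.
by apply/permP => j; apply: c_inj; have := E' (lshift k j); rewrite !block_funl.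
Qed.

(** An arrow compares two preimages under the permutation; in the corner both are values of [a],
    which is increasing. *)
Lemma Gsigma_corner tau rho (u v : vertex k) :
  arrow (Gsigma (block_perm tau rho)) (corner d u) (corner d v) = arrow (Gsigma tau) u v.
Proof.
rewrite !(is_Gsigma_arrow (GsigmaP _)) !vcol_corner (inj_eq (@rshift_inj d k)).
rewrite !vrow_corner -!addnS !eqn_add2l !block_permV /=.
by rewrite !block_funr !a_lt.
Qed.

Lemma Tsigma_corner tau rho (u : vertex k) :
  Tsigma (block_perm tau rho) (bar_weight lambda) (corner d u) =
  Tsigma tau (bar_weight (mu_weight lambda a)) u.
Proof.
have [n] := ubnP (k - vrow u)%N; elim: n u => // n IH u kn.
have [tu|tu] := boolP (top u).
  by rewrite !Tsigma_top ?top_corner // vcol_corner block_permV block_funr bar_mu_weight.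
have ur : ((vrow u).+1 < k)%N by rewrite ltn_neqAle vrow_lt andbT; apply: tu.
have [||u' ru' cu'] := @vertex_ex k (vrow u).+1 (vcol u) => //.
  by rewrite ltnW // ltnS vcol_le.
have cu : vcol u' = vcol u by apply: val_inj.
have rd : vrow (corner d u') = (vrow (corner d u)).+1 by rewrite !vrow_corner ru' addnS.
have cd : vcol (corner d u') = vcol (corner d u) by rewrite !vcol_corner cu.
rewrite (Tsigma_down _ _ rd cd) (Tsigma_down _ _ ru' cu) Gsigma_corner IH //.
by rewrite ru'; lia.
Qed.

(** Entries of a column differ from its top entry by integers, so an integral distance between two
    columns forces both of their indices into A. *)
Lemma Tsigma_sep tau rho (x y : vertex (d + k)) :
  is_int (Tsigma (block_perm tau rho) (bar_weight lambda) x -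
          Tsigma (block_perm tau rho) (bar_weight lambda) y) ->
  vcol x = vcol y \/ in_corner x /\ in_corner y.
Proof.
set s := block_perm tau rho.
have [p pE] := Tsigma_nat s (bar_weight lambda) x.
have [q qE] := Tsigma_nat s (bar_weight lambda) y; rewrite pE qE => -[z zE].
have [|ne] := eqVneq (vcol x) (vcol y); [by left | right].
have [||] := @lambda_a ((s^-1)%g (vcol x)) ((s^-1)%g (vcol y)).
- by rewrite (inj_eq perm_inj).
- exists (z - p%:Z + q%:Z + ((s^-1)%g (vcol x) : nat)%:Z - ((s^-1)%g (vcol y) : nat)%:Z).
  rewrite intrB !intrD intrN -zE /bar_weight -!pmulrn; ring.
have cor (w : vertex (d + k)) : (exists t, (s^-1)%g (vcol w) = a t) -> in_corner w.
  move=> [t]; rewrite block_permV /in_corner -[vcol w]splitK.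
  case: (split _) => j /=; last by rewrite leq_addr.
  by rewrite block_funl => E; case/eqP: (c_out t (rho j)).
by move=> /cor ? /cor ?.
Qed.

Lemma block_perm_relation tau rho : relation_weight tau (mu_weight lambda a) ->
  relation_weight (block_perm tau rho) lambda.
Proof.
apply: relation_graph_corner; first exact: Tsigma_corner.
exact: Tsigma_sep.
Qed.

End Permutations.

Theorem theorem5p9 (R : realType) (n k : nat) (lambda : 'I_n -> R[i])
    (k_bounds : (1 <= k <= n)%N)
    (A : {set 'I_n}) (a : 'I_k -> 'I_n)
    (a_incr : forall i j : 'I_k, (i < j)%N -> (a i < a j)%N)
    (A_eq : A = [set a i | i : 'I_k])
    (lambda_A : forall i j : 'I_n,
       i != j -> is_int (lambda i - lambda j) -> i \in A /\ j \in A)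
    (mu_rel : exists tau : 'S_k, relation_weight tau (mu_weight lambda a)) :
  (#|[set tau : 'S_k | `[< relation_weight tau (mu_weight lambda a) >]]|
     * (n - k)`!
   <= #|[set sigma : 'S_n | `[< relation_weight sigma lambda >]]|)%N.
Proof.
have [d nE] : exists d, n = (d + k)%N by exists (n - k)%N; rewrite subnK //; case/andP: k_bounds.
subst n; rewrite addnK.
have cA : #|~: A| = d.
  by rewrite cardsCs setCK card_ord A_eq card_imset ?card_ord ?addnK //; exact: a_inj.
(* [c] enumerates the complement of [A]. *)
pose c (j : 'I_d) : 'I_(d + k) := enum_val (cast_ord (esym cA) j).
have c_inj : injective c by move=> i j /enum_val_inj/cast_ord_inj.
have c_out i j : c j != a i.
  have := enum_valP (cast_ord (esym cA) j); rewrite -/(c j) inE.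
  by apply: contraNneq => ->; rewrite A_eq; apply/imsetP; exists i.
have lambda_a (i j : 'I_(d + k)) : i != j -> is_int (lambda i - lambda j) ->
    (exists s, i = a s) /\ (exists s, j = a s).
  move=> ij /(lambda_A i j ij)[]; rewrite A_eq => /imsetP[s _ ->] /imsetP[t _ ->].
  by split; [exists s | exists t].
(* The left-hand side counts the pairs of a suitable tau and an arbitrary rho in S_d. *)
rewrite -card_Sn -cardsT -cardsX.
rewrite -(card_imset _ (@block_perm_inj _ _ _ _ a_incr c_inj c_out)) subset_leq_card //.
apply/subsetP => _ /imsetP[[tau rho] + ->]; rewrite !inE andbT /= => /asboolP rel.
by apply/asboolP; apply: block_perm_relation.
Qed.
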